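(* Consider the spatial Newtonian three-body problem with masses $m_1,m_2,m_3>0$, center of mass at the origin and zero linear momentum. Let $H<0$ be a value of the energy and $J\in\mathbb{R}^3$ a value of the angular momentum. Then there exists a number $I_0=I_0(m_j,H,J)>0$ such that every orbit of the three-body problem with energy $H$ and angular momentum $J$ which begins in the region $\{I>I_0\}$ enters the region $\{I\le I_0\}$ in forwards or backwards time.
   Context: Three point masses $m_1,m_2,m_3>0$ with positions $q_1,q_2,q_3\in\mathbb{R}^3$ move according to Newton's equations $m_i\ddot q_i=\sum_{j\ne i} m_im_j (q_j-q_i)/|q_j-q_i|^3$ (gravitational constant $1$), with $\sum m_iq_i=0$ and $\sum m_i\dot q_i=0$. The energy is $\frac12\sum_i m_i|\dot q_i|^2-\sum_{i<j} m_im_j/|q_i-q_j|$, the angular momentum is $\sum_i m_i\, q_i\times\dot q_i\in\mathbb{R}^3$, and the moment of inertia is $I=\sum_i m_i|q_i|^2$. Convention on singularities: one may either exclude orbits that have a binary collision, or continue them through binary collisions by Levi-Civita regularization. *)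

(* Defs.v *)
(* Stdlib reals with Coquelicot. *)
From Stdlib Require Import Reals.
From Coquelicot Require Import Coquelicot.
Open Scope R_scope.

(* A notation, so that Coquelicot's canonical structures on products apply. *)
Notation vec3 := (R * R * R)%type.

Definition dot (u w : vec3) : R :=
  let '(u1, u2, u3) := u in let '(w1, w2, w3) := w in
  u1 * w1 + u2 * w2 + u3 * w3.

Definition cross (u w : vec3) : vec3 :=
  let '(u1, u2, u3) := u in let '(w1, w2, w3) := w in
  (u2 * w3 - u3 * w2, u3 * w1 - u1 * w3, u1 * w2 - u2 * w1).

Definition enorm (u : vec3) : R := sqrt (dot u u).

Inductive body : Set := body1 | body2 | body3.

Definition body_eq_dec (i j : body) : {i = j} + {i <> j}.
Proof. decide equality. Defined.

Definition sum_bodies {G : AbelianGroup} (f : body -> G) : G :=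
  plus (plus (f body1) (f body2)) (f body3).

Definition sum_other_bodies {G : AbelianGroup} (i : body) (f : body -> G) : G :=
  sum_bodies (fun j => if body_eq_dec i j then zero else f j).

Definition moment_of_inertia (m : body -> R) (x : body -> vec3) : R :=
  sum_bodies (fun i => m i * enorm (x i) ^ 2).

Definition energy (m : body -> R) (x w : body -> vec3) : R :=
  / 2 * sum_bodies (fun i => m i * enorm (w i) ^ 2)
  - (m body1 * m body2 / enorm (minus (x body1) (x body2))
     + m body1 * m body3 / enorm (minus (x body1) (x body3))
     + m body2 * m body3 / enorm (minus (x body2) (x body3))).

Definition angular_momentum (m : body -> R) (x w : body -> vec3) : vec3 :=
  sum_bodies (fun i => scal (m i) (cross (x i) (w i))).

Definition centered (m : body -> R) (x : body -> vec3) : Prop :=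
  sum_bodies (fun i => scal (m i) (x i)) = zero.

Definition zero_momentum (m : body -> R) (w : body -> vec3) : Prop :=
  sum_bodies (fun i => scal (m i) (w i)) = zero.

Definition force (m : body -> R) (x : body -> vec3) (i : body) : vec3 :=
  sum_other_bodies i (fun j =>
    scal (m i * m j / enorm (minus (x j) (x i)) ^ 3) (minus (x j) (x i))).

Definition in_interval (a b : Rbar) (t : R) : Prop :=
  Rbar_lt a t /\ Rbar_lt t b.

(* [q i t] and [v i t] are the position and the velocity of body [i] at time
   [t]; their values outside the open interval (a, b) are irrelevant. *)
Definition solution (m : body -> R) (a b : Rbar) (q v : body -> R -> vec3) : Prop :=
  forall t, in_interval a b t ->
    (forall i j, i <> j -> q i t <> q j t) /\
    (forall i, is_derive (q i) t (v i t)) /\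
    (forall i, exists acc : vec3,
       is_derive (v i) t acc /\
       scal (m i) acc = force m (fun j => q j t) i).

Definition maximal_solution (m : body -> R) (a b : Rbar)
    (q v : body -> R -> vec3) : Prop :=
  solution m a b q v /\
  forall (a' b' : Rbar) (q' v' : body -> R -> vec3),
    Rbar_le a' a -> Rbar_le b b' ->
    solution m a' b' q' v' ->
    (forall i t, in_interval a b t -> q' i t = q i t) ->
    a' = a /\ b' = b.

Definition binary_collision_along (F : (R -> Prop) -> Prop)
    (q : body -> R -> vec3) : Prop :=
  exists c : body -> vec3,
    (forall i, filterlim (q i) F (locally (c i))) /\
    exists i j k, i <> j /\ c i = c j /\ c k <> c i.

Definition has_binary_collision (a b : Rbar) (q : body -> R -> vec3) : Prop :=
  (exists T : R, a = Finite T /\ binary_collision_along (at_right T) q) \/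
  (exists T : R, b = Finite T /\ binary_collision_along (at_left T) q).

(* Orbits with a binary collision are excluded rather than regularized.  Both
   orbits defined for all time and orbits which begin or end in a triple
   collision remain. *)
Definition orbit (m : body -> R) (a b : Rbar) (q v : body -> R -> vec3) : Prop :=
  Rbar_lt a 0 /\ Rbar_lt 0 b /\
  maximal_solution m a b q v /\
  ~ has_binary_collision a b q.

(* Main.v *)
Require Import Defs.
From Stdlib Require Import Reals Lra Lia List Classical.
From Coquelicot Require Import Coquelicot.
Open Scope R_scope.

(* Suppose [I > I0] along the whole orbit.  Negative energy forces some mutual
   distance to be at most [R0], so for large [I0] two bodies [i], [j] stay within
   [R0] of each other while [k] stays at distance at least [D] from both, and by
   continuity the pair does not change.  The angular momentum of the pair is
   bounded by energy conservation, hence so is [|q_k x v_k|], and for [D] large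
   the attraction in [|q_k|'' = |q_k x v_k|^2 / |q_k|^3 + q_k . a_k / |q_k|]
   dominates: [|q_k|] is strictly concave.  A positive function cannot be
   strictly concave on the whole line, so the orbit ends at a finite time, say
   [b].  There [q_k] converges, and so does [|q_i - q_j|^2], whose derivative is
   bounded.  If the latter limit is zero, the orbit ends in a binary collision;
   otherwise positions and velocities converge to a noncollision state, from
   which the solution extends by Picard's theorem.  Both are excluded. *)

(** The obstacle is a finite endpoint of the orbit: the velocities of the pair may be unbounded
    there, so [q_i] and [q_j] cannot be shown to converge by bounding their derivatives. Their
    squared distance can: with [r = |q_i - q_j|], energy conservation bounds the relative velocity
    by a multiple of [r^(-1/2)], and the derivative of [r^2] stays bounded. If [r] tends to zero,
    the fixed centre of mass and the limit of [q_k] force [q_i] and [q_j] to one common limit. The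
    pair cannot change because [D >= R0 + 1] leaves a gap between [R0] and [D] that no mutual
    distance can enter. Concavity compares orders: the centrifugal term decays like [|q_k|^(-3)],
    the attraction like [|q_k|^(-2)]. The bound on [|q_k x v_k|] only uses outer distances at least
    1, so it does not depend on [D], and [D] can be chosen after it. [R0] is the sum of the mass
    products divided by [-H], and [I0] is the value that Lagrange's identity gives to [I] when all
    three distances equal [D + R0]. The backward endpoint is reduced to the forward one by time
    reversal. *)

(** * Picard iteration *)

(* [ring] does not see through Coquelicot's canonical structures on [R]. *)
Ltac real_ring :=
  repeat match goal with
  | |- context [@RInt ?V ?f ?x ?y] =>
      let r := fresh in pose (r := @Datatypes.id R (@RInt V f x y)); change (@RInt V f x y) with r; clearbody r
  end;
  match goal with |- @eq _ ?x ?y => change (@eq R x y) end; ring.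

Lemma is_derive_eq (f : R -> R) (t l l' : R) :
  l = l' -> is_derive f t l -> is_derive f t l'.
Proof. now intros <-. Qed.

(** States are functions on an arbitrary index type. Bounding each coordinate avoids forming a
    supremum, so finiteness of the index type enters only when local constants have to be made
    uniform. *)
Definition sup_close {S : Type} (d : R) (y z : S -> R) : Prop :=
  forall i, Rabs (y i - z i) <= d.

(** Serves twice: on the time variable it extends Picard iterates to the whole line, on the
    coordinates of the state it truncates the field to a cube. *)
Definition clamp (lo hi x : R) : R := Rmax lo (Rmin hi x).

Lemma clamp_in (lo hi x : R) : lo <= hi -> lo <= clamp lo hi x <= hi.
Proof. unfold clamp, Rmax, Rmin; intros; repeat destruct Rle_dec; lra. Qed.

Lemma clamp_id (lo hi x : R) : lo <= x <= hi -> clamp lo hi x = x.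
Proof. unfold clamp, Rmax, Rmin; intros; repeat destruct Rle_dec; lra. Qed.

Lemma clamp_contract (lo hi x y : R) :
  Rabs (clamp lo hi x - clamp lo hi y) <= Rabs (x - y).
Proof.
  unfold clamp, Rmax, Rmin, Rabs;
    repeat destruct Rle_dec; repeat destruct Rcase_abs; lra.
Qed.

Lemma continuous_lipschitz (g : R -> R) (K : R) :
  (forall s t, Rabs (g s - g t) <= K * Rabs (s - t)) ->
  forall t, continuous g t.
Proof.
  intros Hg t. apply filterlim_locally; intros eps.
  assert (HK : 0 < Rabs K + 1) by (pose proof (Rabs_pos K); lra).
  assert (Hd : 0 < eps / (Rabs K + 1)) by (apply Rdiv_lt_0_compat; [apply cond_pos | lra]).
  exists (mkposreal _ Hd); intros s Hs.
  change (Rabs (s - t) < eps / (Rabs K + 1)) in Hs.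
  change (Rabs (g s - g t) < eps).
  apply Rle_lt_trans with (1 := Hg s t).
  apply Rle_lt_trans with ((Rabs K + 1) * Rabs (s - t)).
  - apply Rmult_le_compat_r; [apply Rabs_pos | pose proof (Rle_abs K); lra].
  - apply (Rmult_lt_compat_l (Rabs K + 1)) in Hs; [|lra].
    replace ((Rabs K + 1) * (eps / (Rabs K + 1))) with (pos eps) in Hs by (field; lra).
    exact Hs.
Qed.

Lemma ex_RInt_continuous_all (g : R -> R) :
  (forall t, continuous g t) -> forall s t, ex_RInt g s t.
Proof. intros Hg s t. apply (@ex_RInt_continuous R_CompleteNormedModule); auto. Qed.

Lemma abs_RInt_le_dist (g : R -> R) (M s t : R) :
  (forall u, continuous g u) -> (forall u, Rabs (g u) <= M) ->
  Rabs (RInt g s t) <= M * Rabs (t - s).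
Proof.
  intros Hc HM. destruct (Rle_dec s t) as [Hst|Hst].
  - rewrite (Rabs_pos_eq (t - s)) by lra. rewrite Rmult_comm.
    apply abs_RInt_le_const; auto. now apply ex_RInt_continuous_all.
  - rewrite <- opp_RInt_swap by now apply ex_RInt_continuous_all.
    change (Rabs (- RInt g t s) <= M * Rabs (t - s)).
    rewrite Rabs_Ropp, (Rabs_left1 (t - s)) by lra.
    replace (M * - (t - s)) with ((s - t) * M) by ring.
    apply abs_RInt_le_const; auto; [lra | now apply ex_RInt_continuous_all].
Qed.


(** Clamping the upper limit of integration makes every iterate a Lipschitz path on the whole line
    and the contraction estimate uniform in [t]. *)
Definition picard_step {S : Type} (f : S -> (S -> R) -> R) (y0 : S -> R)
    (b tau : R) (y : S -> R -> R) : S -> R -> R :=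
  fun i t => y0 i + RInt (fun s => f i (fun j => y j s)) b (clamp (b - tau) (b + tau) t).

Fixpoint picard_iter {S : Type} (f : S -> (S -> R) -> R) (y0 : S -> R)
    (b tau : R) (n : nat) : S -> R -> R :=
  match n with
  | O => fun i _ => y0 i
  | Datatypes.S p => picard_step f y0 b tau (picard_iter f y0 b tau p)
  end.

Definition lipschitz_path {S : Type} (B : R) (y : S -> R -> R) : Prop :=
  forall i s t, Rabs (y i s - y i t) <= B * Rabs (s - t).

Definition lipschitz_field {S : Type} (L : R) (f : S -> (S -> R) -> R) : Prop :=
  forall y z d, sup_close d y z -> forall i, Rabs (f i y - f i z) <= L * d.

Lemma lipschitz_field_continuous {S : Type} (L B : R) (f : S -> (S -> R) -> R) y :
  lipschitz_field L f -> lipschitz_path B y ->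
  forall i t, continuous (fun s => f i (fun j => y j s)) t.
Proof.
  intros Hf Hy i. apply continuous_lipschitz with (L * B). intros s t.
  rewrite Rmult_assoc. apply (Hf (fun j => y j s) (fun j => y j t)).
  intros j. apply Hy.
Qed.

Lemma picard_step_lipschitz {S : Type} (L B : R) (f : S -> (S -> R) -> R) y0 b tau y :
  0 <= B -> lipschitz_field L f -> (forall i z, Rabs (f i z) <= B) ->
  lipschitz_path B y -> lipschitz_path B (picard_step f y0 b tau y).
Proof.
  intros HB Hf HfB Hy i s t. unfold picard_step.
  set (g := fun s0 => f i (fun j => y j s0)).
  assert (Hg : forall u, continuous g u)
    by (intros u; now apply lipschitz_field_continuous with (L := L) (B := B)).
  set (s' := clamp _ _ s); set (t' := clamp _ _ t).
  assert (E : RInt g b s' = RInt g b t' + RInt g t' s')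
    by (symmetry; apply (RInt_Chasles g); now apply ex_RInt_continuous_all).
  rewrite E.
  replace (y0 i + (RInt g b t' + RInt g t' s') - (y0 i + RInt g b t'))
    with (RInt g t' s') by real_ring.
  apply Rle_trans with (B * Rabs (s' - t')).
  - apply abs_RInt_le_dist; auto. intros u; apply HfB.
  - apply Rmult_le_compat_l; auto. apply clamp_contract.
Qed.

(** The integrands differ by at most [L * d] and the clamped interval of integration has length at
    most [tau]. *)
Lemma picard_step_contract {S : Type} (L B : R) (f : S -> (S -> R) -> R) y0 b tau y z d :
  0 <= L -> 0 < tau -> L * tau <= / 2 -> 0 <= d -> lipschitz_field L f ->
  lipschitz_path B y -> lipschitz_path B z ->
  (forall i t, Rabs (y i t - z i t) <= d) ->
  forall i t, Rabs (picard_step f y0 b tau y i t - picard_step f y0 b tau z i t) <= d / 2.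
Proof.
  intros HL Ht HLt Hd Hf Hy Hz Hyz i t. unfold picard_step.
  set (g := fun s0 => f i (fun j => y j s0)).
  set (h := fun s0 => f i (fun j => z j s0)).
  assert (Hg : forall u, continuous g u)
    by (intros u; now apply lipschitz_field_continuous with (L := L) (B := B)).
  assert (Hh : forall u, continuous h u)
    by (intros u; now apply lipschitz_field_continuous with (L := L) (B := B)).
  set (t' := clamp _ _ t).
  assert (E : RInt g b t' - RInt h b t' = RInt (fun u => g u - h u) b t')
    by (symmetry; apply (RInt_minus g h); now apply ex_RInt_continuous_all).
  replace (y0 i + RInt g b t' - (y0 i + RInt h b t'))
    with (RInt g b t' - RInt h b t') by real_ring.
  rewrite E.
  apply Rle_trans with (L * d * Rabs (t' - b)).
  - apply abs_RInt_le_dist.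
    + intros u. apply (continuous_minus g h); auto.
    + intros u. apply (Hf (fun j => y j u) (fun j => z j u)). intros j; apply Hyz.
  - apply Rle_trans with (L * d * tau).
    + apply Rmult_le_compat_l; [now apply Rmult_le_pos|].
      assert (Hc := clamp_in (b - tau) (b + tau) t ltac:(lra)). fold t' in Hc.
      apply Rabs_le; lra.
    + replace (L * d * tau) with (L * tau * d) by ring.
      apply Rle_trans with (/ 2 * d); [now apply Rmult_le_compat_r | lra].
Qed.

Lemma picard_iter_lipschitz {S : Type} (L B : R) (f : S -> (S -> R) -> R) y0 b tau n :
  0 <= B -> lipschitz_field L f -> (forall i z, Rabs (f i z) <= B) ->
  lipschitz_path B (picard_iter f y0 b tau n).
Proof.
  intros HB Hf HfB. induction n as [|n IH]; simpl.
  - intros i s t. rewrite Rminus_eq_0, Rabs_R0. apply Rmult_le_pos; auto. apply Rabs_pos.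
  - now apply picard_step_lipschitz with L.
Qed.

Lemma picard_iter_diff {S : Type} (L B : R) (f : S -> (S -> R) -> R) y0 b tau n :
  0 <= B -> 0 <= L -> 0 < tau -> L * tau <= / 2 ->
  lipschitz_field L f -> (forall i z, Rabs (f i z) <= B) ->
  forall i t, Rabs (picard_iter f y0 b tau (Datatypes.S n) i t - picard_iter f y0 b tau n i t)
    <= B * tau / 2 ^ n.
Proof.
  intros HB HL Ht HLt Hf HfB.
  assert (HBt : 0 <= B * tau) by (apply Rmult_le_pos; lra).
  induction n as [|n IH]; intros i t.
  - simpl picard_iter. unfold picard_step.
    match goal with |- Rabs (?x + ?r - ?x) <= _ => replace (x + r - x) with r by real_ring end.
    apply Rle_trans with (B * Rabs (clamp (b - tau) (b + tau) t - b)).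
    + apply abs_RInt_le_dist; [|intros u; apply HfB].
      intros u. apply (lipschitz_field_continuous L B f (fun j _ => y0 j)); auto.
      apply (picard_iter_lipschitz L B f y0 b tau O); auto.
    + simpl pow. replace (B * tau / 1) with (B * tau) by field.
      apply Rmult_le_compat_l; auto.
      assert (Hc := clamp_in (b - tau) (b + tau) t ltac:(lra)).
      apply Rabs_le; lra.
  - replace (B * tau / 2 ^ Datatypes.S n) with (B * tau / 2 ^ n / 2)
      by (simpl; field; apply pow_nonzero; lra).
    apply (picard_step_contract L B f y0 b tau (picard_iter f y0 b tau (Datatypes.S n))
      (picard_iter f y0 b tau n)); auto.
    + apply Rdiv_le_0_compat; auto. apply pow_lt; lra.
    + now apply picard_iter_lipschitz with L.
    + now apply picard_iter_lipschitz with L.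
Qed.

(** The right-hand side is the exact sum of the geometric bounds from [n] to [n + p - 1]; keeping
    the subtracted tail is what lets the induction on [p] close. *)
Lemma geometric_cauchy (u : nat -> R) (C : R) :
  (forall n, Rabs (u (S n) - u n) <= C / 2 ^ n) ->
  forall n p, Rabs (u (n + p)%nat - u n) <= 2 * C / 2 ^ n - 2 * C / 2 ^ (n + p).
Proof.
  intros Hu n p. induction p as [|p IH].
  - rewrite Nat.add_0_r. rewrite !Rminus_eq_0, Rabs_R0. lra.
  - replace (n + S p)%nat with (S (n + p)) by lia.
    replace (u (S (n + p)) - u n) with (u (S (n + p)) - u (n + p)%nat + (u (n + p)%nat - u n)) by ring.
    eapply Rle_trans; [apply Rabs_triang|].
    specialize (Hu (n + p)%nat).
    replace (2 * C / 2 ^ S (n + p)) with (C / 2 ^ (n + p))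
      by (simpl; field; apply pow_nonzero; lra).
    replace (2 * C / 2 ^ (n + p)) with (2 * (C / 2 ^ (n + p))) in IH
      by (field; apply pow_nonzero; lra).
    lra.
Qed.

Lemma is_lim_seq_geom_half (C : R) : is_lim_seq (fun n => C / 2 ^ n) 0.
Proof.
  apply is_lim_seq_ext with (fun n => C * (/ 2) ^ n).
  - intros n. rewrite pow_inv. reflexivity.
  - replace (Finite 0) with (Rbar_mult C 0) by (simpl; f_equal; ring).
    apply is_lim_seq_scal_l. apply is_lim_seq_geom. rewrite Rabs_pos_eq; lra.
Qed.

Lemma geometric_limit (u : nat -> R) (C : R) : 0 <= C ->
  (forall n, Rabs (u (S n) - u n) <= C / 2 ^ n) ->
  forall n, Rabs (u n - real (Lim_seq u)) <= 2 * C / 2 ^ n.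
Proof.
  intros HC Hu.
  assert (Hpos : forall n, 0 <= 2 * C / 2 ^ n)
    by (intros n; apply Rdiv_le_0_compat; [lra | apply pow_lt; lra]).
  assert (Hnp : forall n p, Rabs (u (n + p)%nat - u n) <= 2 * C / 2 ^ n).
  { intros n p. generalize (geometric_cauchy u C Hu n p) (Hpos (n + p)%nat). lra. }
  assert (Hex : ex_finite_lim_seq u).
  { apply ex_lim_seq_cauchy_corr. intros eps.
    assert (Hl := is_lim_seq_geom_half (2 * C)).
    apply is_lim_seq_spec in Hl.
    destruct (Hl (mkposreal (eps / 2) ltac:(destruct eps; simpl; lra))) as [N HN].
    simpl in HN. exists N. intros n m Hn Hm.
    specialize (HN N (le_n N)). rewrite Rminus_0_r, Rabs_pos_eq in HN by auto.
    generalize (Hnp N (n - N)%nat) (Hnp N (m - N)%nat).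
    replace (N + (n - N))%nat with n by lia. replace (N + (m - N))%nat with m by lia.
    intros H1 H2. replace (u n - u m) with ((u n - u N) - (u m - u N)) by ring.
    eapply Rle_lt_trans; [apply Rabs_triang|]. rewrite Rabs_Ropp. lra. }
  apply Lim_seq_correct' in Hex. intros n.
  assert (Hl : is_lim_seq (fun p => Rabs (u (n + p)%nat - u n)) (Rabs (Lim_seq u - u n))).
  { apply (is_lim_seq_abs _ (Lim_seq u - u n)).
    apply is_lim_seq_minus'; [|apply is_lim_seq_const].
    apply is_lim_seq_ext with (fun p => u (p + n)%nat).
    - intros p; f_equal; lia.
    - now apply is_lim_seq_incr_n. }
  rewrite Rabs_minus_sym.
  apply (is_lim_seq_le _ _ _ _ (Hnp n) Hl (is_lim_seq_const _)).
Qed.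

(** The iterates converge geometrically to a fixed point of the integral operator. For
    [|t - b| < tau] the clamp is inactive, and differentiating the integral gives the equation. *)
Lemma picard_global {S : Type} (L B : R) (f : S -> (S -> R) -> R) (y0 : S -> R) (b : R) :
  0 <= B -> 0 <= L -> lipschitz_field L f -> (forall i z, Rabs (f i z) <= B) ->
  exists (tau : R) (y : S -> R -> R), 0 < tau /\ lipschitz_path B y /\
    (forall i, y i b = y0 i) /\
    forall t, Rabs (t - b) < tau -> forall i, is_derive (y i) t (f i (fun j => y j t)).
Proof.
  intros HB HL Hf HfB.
  (* Adding 1 keeps [tau] meaningful for [L = 0] and still gives [L * tau <= / 2]. *)
  set (tau := / (2 * (L + 1))).
  assert (Ht : 0 < tau) by (apply Rinv_0_lt_compat; lra).
  assert (HLt : L * tau <= / 2).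
  { assert ((L + 1) * tau = / 2) by (unfold tau; field; lra). nra. }
  assert (HBt : 0 <= B * tau) by (apply Rmult_le_pos; lra).
  set (p := picard_iter f y0 b tau).
  set (y := fun i t => real (Lim_seq (fun n => p n i t))).
  assert (Hlim : forall n i t, Rabs (p n i t - y i t) <= 2 * (B * tau) / 2 ^ n).
  { intros n i t. apply (geometric_limit (fun n => p n i t)); auto.
    intros k. now apply picard_iter_diff with L. }
  (* The limit inherits the Lipschitz constant of the iterates. This makes its integrand continuous,
     as the contraction estimate demands of both of its arguments. *)
  assert (Hy : lipschitz_path B y).
  { intros i s t.
    assert (Hle : forall n, Rabs (y i s - y i t) <= B * Rabs (s - t) + 4 * (B * tau) / 2 ^ n).
    { intros n. replace (y i s - y i t) with (- (p n i s - y i s) + (p n i s - p n i t) + (p n i t - y i t)) by ring.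
      eapply Rle_trans; [apply Rabs_triang|].
      eapply Rle_trans; [apply Rplus_le_compat_r, Rabs_triang|].
      rewrite Rabs_Ropp. generalize (Hlim n i s) (Hlim n i t)
        (picard_iter_lipschitz L B f y0 b tau n HB Hf HfB i s t). fold p. lra. }
    assert (Hl : is_lim_seq (fun n => B * Rabs (s - t) + 4 * (B * tau) / 2 ^ n) (B * Rabs (s - t) + 0)).
    { apply is_lim_seq_plus'; [apply is_lim_seq_const | apply is_lim_seq_geom_half]. }
    generalize (is_lim_seq_le _ _ _ _ Hle (is_lim_seq_const _) Hl). simpl. lra. }
  (* Both [y] and its image under the operator lie within [B * tau / 2 ^ n] of the iterate of index
     [n + 1]. *)
  assert (Hfix : forall i t, y i t = picard_step f y0 b tau y i t).
  { intros i t. apply Rminus_diag_uniq.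
    assert (Hle : forall n, Rabs (y i t - picard_step f y0 b tau y i t) <= 2 * (B * tau) / 2 ^ n).
    { intros n.
      assert (H1 := Hlim (Datatypes.S n) i t).
      assert (Hd : 0 <= 2 * (B * tau) / 2 ^ n) by (apply Rdiv_le_0_compat; [lra | apply pow_lt; lra]).
      assert (H2 := picard_step_contract L B f y0 b tau (p n) y _ HL Ht HLt Hd Hf
        (picard_iter_lipschitz L B f y0 b tau n HB Hf HfB) Hy (Hlim n) i t).
      change (picard_step f y0 b tau (p n)) with (p (Datatypes.S n)) in H2.
      replace (2 * (B * tau) / 2 ^ Datatypes.S n) with (2 * (B * tau) / 2 ^ n / 2) in H1
        by (simpl; field; apply pow_nonzero; lra).
      replace (y i t - picard_step f y0 b tau y i t) with
        (- (p (Datatypes.S n) i t - y i t) + (p (Datatypes.S n) i t - picard_step f y0 b tau y i t)) by ring.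
      eapply Rle_trans; [apply Rabs_triang|]. rewrite Rabs_Ropp. lra. }
    apply Rabs_eq_0, Rle_antisym; [|apply Rabs_pos].
    apply (is_lim_seq_le _ _ _ _ Hle (is_lim_seq_const _) (is_lim_seq_geom_half _)). }
  exists tau, y. split; [exact Ht | split; [exact Hy | split]].
  - intros i. rewrite Hfix. unfold picard_step. rewrite clamp_id by lra.
    rewrite RInt_point. apply Rplus_0_r.
  - intros t Htb i. apply Rabs_lt_between in Htb.
    set (g := fun s => f i (fun j => y j s)).
    assert (Hg : forall u, continuous g u)
      by (intros u; now apply lipschitz_field_continuous with (L := L) (B := B)).
    apply is_derive_ext_loc with (fun s => y0 i + RInt g b s).
    + assert (Hd : 0 < tau - Rabs (t - b)) by (apply Rlt_0_minus, Rabs_def1; lra).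
      exists (mkposreal _ Hd). intros s Hs.
      change (Rabs (s - t) < tau - Rabs (t - b)) in Hs.
      rewrite (Hfix i s). unfold picard_step. rewrite clamp_id; [reflexivity|].
      assert (Rabs (s - b) < tau).
      { replace (s - b) with ((s - t) + (t - b)) by ring.
        eapply Rle_lt_trans; [apply Rabs_triang|]. lra. }
      apply Rabs_lt_between in H. lra.
    + apply is_derive_eq with (0 + g t); [unfold g; ring|].
      apply (is_derive_plus (fun _ => y0 i) (fun s => RInt g b s)).
      * apply (is_derive_const (y0 i)).
      * apply (is_derive_RInt g _ b); auto.
        apply filter_forall. intros s. now apply (@RInt_correct R_CompleteNormedModule), ex_RInt_continuous_all.
Qed.

(** * Locally Lipschitz fields *)

Definition locally_lipschitz {S : Type} (y0 : S -> R) (g : (S -> R) -> R) : Prop :=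
  exists eps L, 0 < eps /\ 0 <= L /\
    forall y z d, sup_close eps y y0 -> sup_close eps z y0 -> sup_close d y z ->
      Rabs (g y - g z) <= L * d.

Lemma sup_close_weaken {S : Type} (d e : R) (y z : S -> R) :
  d <= e -> sup_close d y z -> sup_close e y z.
Proof. intros H Hd i. apply Rle_trans with d; auto. Qed.

Lemma sup_close_refl {S : Type} (d : R) (y : S -> R) : 0 <= d -> sup_close d y y.
Proof. intros H i. rewrite Rminus_eq_0, Rabs_R0. exact H. Qed.

(** The least of finitely many radii serves all components, and adding the constants avoids
    comparing them. The bound [B] comes from the value at [y0] and the Lipschitz estimate on the
    cube. *)
Lemma locally_lipschitz_common {S : Type} (f : S -> (S -> R) -> R) (y0 : S -> R) (l : list S) :
  (forall i, locally_lipschitz y0 (f i)) ->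
  exists eps L B, 0 < eps /\ 0 <= L /\ 0 <= B /\ forall i, In i l ->
    (forall y, sup_close eps y y0 -> Rabs (f i y) <= B) /\
    (forall y z d, sup_close eps y y0 -> sup_close eps z y0 -> sup_close d y z ->
      Rabs (f i y - f i z) <= L * d).
Proof.
  intros Hf. induction l as [|i l (eps & L & B & He & HL & HB & IH)].
  - exists 1, 0, 0. repeat split; try lra; contradiction.
  - destruct (Hf i) as (eps' & L' & He' & HL' & Hi).
    assert (HM : 0 < Rmin eps eps') by now apply Rmin_pos.
    exists (Rmin eps eps'), (L + L'), (B + (Rabs (f i y0) + L' * Rmin eps eps')).
    assert (HB' : 0 <= Rabs (f i y0) + L' * Rmin eps eps').
    { generalize (Rabs_pos (f i y0)) (Rmult_le_pos L' _ HL' (Rlt_le _ _ HM)). lra. }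
    split; [exact HM | split; [lra | split; [lra |]]].
    intros j [<-|Hj]; split.
    + intros y Hy.
      assert (H := Hi y y0 (Rmin eps eps')
        (sup_close_weaken _ _ _ _ (Rmin_r _ _) Hy) (sup_close_refl _ _ (Rlt_le _ _ He')) Hy).
      replace (f i y) with ((f i y - f i y0) + f i y0) by ring.
      eapply Rle_trans; [apply Rabs_triang|]. lra.
    + intros y z d Hy Hz Hd.
      assert (H := Hi y z d (sup_close_weaken _ _ _ _ (Rmin_r _ _) Hy)
        (sup_close_weaken _ _ _ _ (Rmin_r _ _) Hz) Hd).
      assert (0 <= d) by (eapply Rle_trans; [apply Rabs_pos | apply (Hd i)]).
      assert (0 <= L * d) by now apply Rmult_le_pos. lra.
    + intros y Hy. destruct (IH j Hj) as [H _].
      specialize (H y (sup_close_weaken _ _ _ _ (Rmin_l _ _) Hy)). lra.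
    + intros y z d Hy Hz Hd. destruct (IH j Hj) as [_ H].
      specialize (H y z d (sup_close_weaken _ _ _ _ (Rmin_l _ _) Hy)
        (sup_close_weaken _ _ _ _ (Rmin_l _ _) Hz) Hd).
      assert (0 <= d) by (eapply Rle_trans; [apply Rabs_pos | apply (Hd i)]).
      assert (0 <= L' * d) by now apply Rmult_le_pos. lra.
Qed.

(* Composing the field with the coordinatewise projection onto the cube of
   radius [eps] around [y0] reduces to a bounded, globally Lipschitz field. *)
Lemma picard_local {S : Type} (l : list S) (f : S -> (S -> R) -> R) (y0 : S -> R) (b : R) :
  (forall i, In i l) -> (forall i, locally_lipschitz y0 (f i)) ->
  exists (tau : R) (y : S -> R -> R), 0 < tau /\
    (forall i, y i b = y0 i) /\
    forall t, Rabs (t - b) < tau -> forall i, is_derive (y i) t (f i (fun j => y j t)).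
Proof.
  intros Hl Hf.
  destruct (locally_lipschitz_common f y0 l Hf) as (eps & L & B & He & HL & HB & H).
  set (c := fun (y : S -> R) i => clamp (y0 i - eps) (y0 i + eps) (y i)).
  assert (Hc : forall y, sup_close eps (c y) y0).
  { intros y i. unfold c.
    assert (Hc := clamp_in (y0 i - eps) (y0 i + eps) (y i) ltac:(lra)). apply Rabs_le; lra. }
  destruct (picard_global L B (fun i y => f i (c y)) y0 b HB HL) as (tau & y & Ht & Hlip & Hb & Hd).
  - intros y z d Hyz i. apply (proj2 (H i (Hl i))); auto.
    intros j. eapply Rle_trans; [apply clamp_contract | apply Hyz].
  - intros i z. apply (proj1 (H i (Hl i))); auto.
  (* The path has speed at most [B], so up to time [eps / (B + 1)] it stays in the cube, where the
     projection [c] is the identity. *)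
  - assert (He' : 0 < eps / (B + 1)) by (apply Rdiv_lt_0_compat; lra).
    exists (Rmin tau (eps / (B + 1))), y. split; [now apply Rmin_pos | split; [exact Hb|]].
    intros t Htb i.
    assert (H1 := Rmin_l tau (eps / (B + 1))). assert (H2 := Rmin_r tau (eps / (B + 1))).
    assert (Hin : sup_close eps (fun j => y j t) y0).
    { intros j. rewrite <- Hb. eapply Rle_trans; [apply Hlip|].
      assert (B * Rabs (t - b) <= (B + 1) * (eps / (B + 1))).
      { apply Rmult_le_compat; auto; try lra. apply Rabs_pos. }
      replace ((B + 1) * (eps / (B + 1))) with eps in * by (field; lra). assumption. }
    apply is_derive_eq with (f i (c (fun j => y j t))); [|apply Hd; lra].
    (* [c] fixes the state only coordinate by coordinate. The Lipschitz estimate at distance 0 turns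
       this into equality of field values without functional extensionality. *)
    apply Rminus_diag_uniq, Rabs_eq_0, Rle_antisym; [|apply Rabs_pos].
    replace 0 with (L * 0) by ring. apply (proj2 (H i (Hl i))); auto.
    intros j. unfold c. specialize (Hin j). apply Rabs_le_between in Hin.
    rewrite clamp_id by lra. rewrite Rminus_eq_0, Rabs_R0. lra.
Qed.

(** * Closure properties of local Lipschitz continuity *)

Lemma locally_lipschitz_const {S : Type} (y0 : S -> R) (c : R) :
  locally_lipschitz y0 (fun _ => c).
Proof.
  exists 1, 0. split; [lra | split; [lra|]]. intros y z d _ _ _.
  rewrite Rminus_eq_0, Rabs_R0. lra.
Qed.

Lemma locally_lipschitz_coord {S : Type} (y0 : S -> R) (i : S) :
  locally_lipschitz y0 (fun y => y i).
Proof.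
  exists 1, 1. split; [lra | split; [lra|]]. intros y z d _ _ H. rewrite Rmult_1_l. apply H.
Qed.

Lemma locally_lipschitz_plus {S : Type} (y0 : S -> R) f g :
  locally_lipschitz y0 f -> locally_lipschitz y0 g ->
  locally_lipschitz y0 (fun y => f y + g y).
Proof.
  intros (e1 & L1 & He1 & HL1 & H1) (e2 & L2 & He2 & HL2 & H2).
  exists (Rmin e1 e2), (L1 + L2). split; [now apply Rmin_pos | split; [lra|]].
  intros y z d Hy Hz Hd.
  specialize (H1 y z d (sup_close_weaken _ _ _ _ (Rmin_l _ _) Hy) (sup_close_weaken _ _ _ _ (Rmin_l _ _) Hz) Hd).
  specialize (H2 y z d (sup_close_weaken _ _ _ _ (Rmin_r _ _) Hy) (sup_close_weaken _ _ _ _ (Rmin_r _ _) Hz) Hd).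
  replace (f y + g y - (f z + g z)) with ((f y - f z) + (g y - g z)) by ring.
  eapply Rle_trans; [apply Rabs_triang|]. lra.
Qed.

Lemma locally_lipschitz_mult {S : Type} (y0 : S -> R) f g :
  locally_lipschitz y0 f -> locally_lipschitz y0 g ->
  locally_lipschitz y0 (fun y => f y * g y).
Proof.
  intros (e1 & L1 & He1 & HL1 & H1) (e2 & L2 & He2 & HL2 & H2).
  assert (He := Rmin_pos e1 e2 He1 He2). set (e := Rmin e1 e2) in *.
  assert (B1 : forall y, sup_close e y y0 -> Rabs (f y) <= Rabs (f y0) + L1 * e).
  { intros y Hy.
    assert (H := H1 y y0 e (sup_close_weaken _ _ _ _ (Rmin_l _ _) Hy) (sup_close_refl _ _ (Rlt_le _ _ He1)) Hy).
    replace (f y) with (f y0 + (f y - f y0)) by ring.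
    eapply Rle_trans; [apply Rabs_triang|]. lra. }
  assert (B2 : forall y, sup_close e y y0 -> Rabs (g y) <= Rabs (g y0) + L2 * e).
  { intros y Hy.
    assert (H := H2 y y0 e (sup_close_weaken _ _ _ _ (Rmin_r _ _) Hy) (sup_close_refl _ _ (Rlt_le _ _ He2)) Hy).
    replace (g y) with (g y0 + (g y - g y0)) by ring.
    eapply Rle_trans; [apply Rabs_triang|]. lra. }
  set (M1 := Rabs (f y0) + L1 * e) in *. set (M2 := Rabs (g y0) + L2 * e) in *.
  assert (P1 : 0 <= M1) by (unfold M1; generalize (Rabs_pos (f y0)) (Rmult_le_pos L1 e HL1 (Rlt_le _ _ He)); lra).
  assert (P2 : 0 <= M2) by (unfold M2; generalize (Rabs_pos (g y0)) (Rmult_le_pos L2 e HL2 (Rlt_le _ _ He)); lra).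
  exists e, (M1 * L2 + M2 * L1). split; [exact He | split].
  { generalize (Rmult_le_pos _ _ P1 HL2) (Rmult_le_pos _ _ P2 HL1). lra. }
  intros y z d Hy Hz Hd.
  specialize (H1 y z d (sup_close_weaken _ _ _ _ (Rmin_l _ _) Hy) (sup_close_weaken _ _ _ _ (Rmin_l _ _) Hz) Hd).
  specialize (H2 y z d (sup_close_weaken _ _ _ _ (Rmin_r _ _) Hy) (sup_close_weaken _ _ _ _ (Rmin_r _ _) Hz) Hd).
  replace (f y * g y - f z * g z) with (f y * (g y - g z) + g z * (f y - f z)) by ring.
  eapply Rle_trans; [apply Rabs_triang|]. rewrite !Rabs_mult.
  assert (Rabs (f y) * Rabs (g y - g z) <= M1 * (L2 * d))
    by (apply Rmult_le_compat; auto using Rabs_pos).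
  assert (Rabs (g z) * Rabs (f y - f z) <= M2 * (L1 * d))
    by (apply Rmult_le_compat; auto using Rabs_pos).
  lra.
Qed.

Lemma locally_lipschitz_minus {S : Type} (y0 : S -> R) f g :
  locally_lipschitz y0 f -> locally_lipschitz y0 g ->
  locally_lipschitz y0 (fun y => f y - g y).
Proof.
  intros (e1 & L1 & He1 & HL1 & H1) (e2 & L2 & He2 & HL2 & H2).
  exists (Rmin e1 e2), (L1 + L2). split; [now apply Rmin_pos | split; [lra|]].
  intros y z d Hy Hz Hd.
  specialize (H1 y z d (sup_close_weaken _ _ _ _ (Rmin_l _ _) Hy) (sup_close_weaken _ _ _ _ (Rmin_l _ _) Hz) Hd).
  specialize (H2 y z d (sup_close_weaken _ _ _ _ (Rmin_r _ _) Hy) (sup_close_weaken _ _ _ _ (Rmin_r _ _) Hz) Hd).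
  replace (f y - g y - (f z - g z)) with ((f y - f z) + - (g y - g z)) by ring.
  eapply Rle_trans; [apply Rabs_triang|]. rewrite Rabs_Ropp. lra.
Qed.

Lemma locally_lipschitz_comp {S : Type} (y0 : S -> R) f (h : R -> R) (e K : R) :
  0 < e -> 0 <= K ->
  (forall u v, Rabs (u - f y0) <= e -> Rabs (v - f y0) <= e -> Rabs (h u - h v) <= K * Rabs (u - v)) ->
  locally_lipschitz y0 f -> locally_lipschitz y0 (fun y => h (f y)).
Proof.
  intros He HK Hh (e1 & L & He1 & HL & H1).
  assert (He2 : 0 < e / (L + 1)) by (apply Rdiv_lt_0_compat; lra).
  set (r := Rmin e1 (e / (L + 1))).
  assert (Hr : 0 < r) by now apply Rmin_pos.
  assert (Hin : forall y, sup_close r y y0 -> Rabs (f y - f y0) <= e).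
  { intros y Hy.
    assert (H := H1 y y0 r (sup_close_weaken _ _ _ _ (Rmin_l _ _) Hy) (sup_close_refl _ _ (Rlt_le _ _ He1)) Hy).
    assert (Hr2 : r <= e / (L + 1)) by apply Rmin_r.
    assert (L * r <= (L + 1) * (e / (L + 1))) by (apply Rmult_le_compat; lra).
    replace ((L + 1) * (e / (L + 1))) with e in * by (field; lra). lra. }
  exists r, (K * L). split; [exact Hr | split; [now apply Rmult_le_pos|]].
  intros y z d Hy Hz Hd.
  eapply Rle_trans; [apply Hh; auto|]. rewrite Rmult_assoc. apply Rmult_le_compat_l; auto.
  apply H1; auto; eapply sup_close_weaken; try eassumption; apply Rmin_l.
Qed.

Lemma locally_lipschitz_inv {S : Type} (y0 : S -> R) f :
  0 < f y0 -> locally_lipschitz y0 f -> locally_lipschitz y0 (fun y => / f y).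
Proof.
  intros H0. assert (P : 0 < f y0 * f y0) by now apply Rmult_lt_0_compat.
  (* Within [f y0 / 2] of [f y0] the product [u * v] is at least a quarter of the square of [f y0],
     whence the constant for [/ u - / v]. *)
  apply locally_lipschitz_comp with (e := f y0 / 2) (K := 4 / (f y0 * f y0)); [lra| |].
  - left. apply Rdiv_lt_0_compat; lra.
  - intros u v Hu Hv. apply Rabs_le_between in Hu, Hv.
    replace (/ u - / v) with (- (/ (u * v) * (u - v))) by (field; lra).
    rewrite Rabs_Ropp, Rabs_mult. apply Rmult_le_compat_r; [apply Rabs_pos|].
    assert (f y0 * f y0 / 4 <= u * v).
    { replace (f y0 * f y0 / 4) with ((f y0 / 2) * (f y0 / 2)) by field.
      apply Rmult_le_compat; lra. }
    rewrite Rabs_pos_eq by (left; apply Rinv_0_lt_compat; lra).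
    replace (4 / (f y0 * f y0)) with (/ (f y0 * f y0 / 4)) by (field; lra).
    apply Rinv_le_contravar; lra.
Qed.

Lemma locally_lipschitz_sqrt {S : Type} (y0 : S -> R) f :
  0 < f y0 -> locally_lipschitz y0 f -> locally_lipschitz y0 (fun y => sqrt (f y)).
Proof.
  intros H0. set (s := sqrt (f y0)). assert (Hs : 0 < s) by now apply sqrt_lt_R0.
  assert (Hss : s * s = f y0) by (apply sqrt_sqrt; lra).
  (* With this radius both arguments are at least [f y0 / 4], so the two square roots add up to at
     least [s]. The difference of the roots is [(u - v)] divided by their sum. *)
  apply locally_lipschitz_comp with (e := 3 / 4 * f y0) (K := / s);
    [lra | left; now apply Rinv_0_lt_compat |].
  intros u v Hu Hv. apply Rabs_le_between in Hu, Hv.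
  assert (Hsq : forall x, f y0 / 4 <= x -> s / 2 <= sqrt x).
  { intros x Hx. rewrite <- (sqrt_square (s / 2)) by lra. apply sqrt_le_1; nra. }
  assert (H1 := Hsq u ltac:(lra)). assert (H2 := Hsq v ltac:(lra)).
  assert (E : sqrt u - sqrt v = / (sqrt u + sqrt v) * (u - v)).
  { rewrite <- (sqrt_sqrt u) at 3 by lra. rewrite <- (sqrt_sqrt v) at 3 by lra. field. lra. }
  rewrite E, Rabs_mult. apply Rmult_le_compat_r; [apply Rabs_pos|].
  rewrite Rabs_pos_eq by (left; apply Rinv_0_lt_compat; lra).
  apply Rinv_le_contravar; lra.
Qed.

(** * Newton's equations in coordinates *)

Inductive axis : Set := axis1 | axis2 | axis3.

Definition coord (c : axis) (u : vec3) : R :=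
  match c with axis1 => fst (fst u) | axis2 => snd (fst u) | axis3 => snd u end.

Lemma vec3_ext (u w : vec3) : (forall c, coord c u = coord c w) -> u = w.
Proof.
  intros H. destruct u as [[u1 u2] u3], w as [[w1 w2] w3].
  generalize (H axis1) (H axis2) (H axis3); simpl. congruence.
Qed.

Lemma coord_plus c (u w : vec3) : coord c (plus u w) = coord c u + coord c w.
Proof. now destruct c. Qed.

Lemma coord_minus c (u w : vec3) : coord c (minus u w) = coord c u - coord c w.
Proof. now destruct c. Qed.

Lemma coord_scal c (k : R) (u : vec3) : coord c (scal k u) = k * coord c u.
Proof. now destruct c. Qed.

Lemma coord_zero c : coord c (zero : vec3) = 0.
Proof. now destruct c. Qed.

Lemma coord_opp c (u : vec3) : coord c (opp u) = - coord c u.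
Proof. now destruct c. Qed.

Lemma dot_coord (u w : vec3) :
  dot u w = coord axis1 u * coord axis1 w + coord axis2 u * coord axis2 w + coord axis3 u * coord axis3 w.
Proof. now destruct u as [[? ?] ?], w as [[? ?] ?]. Qed.

Lemma dot_ge0 u : 0 <= dot u u.
Proof. rewrite dot_coord. nra. Qed.

Lemma dot_gt0 u : u <> zero -> 0 < dot u u.
Proof.
  intros H. destruct (Rle_lt_or_eq_dec _ _ (dot_ge0 u)) as [|E]; auto.
  exfalso; apply H, vec3_ext. rewrite dot_coord in E. intros c; rewrite coord_zero.
  destruct c; nra.
Qed.

Lemma minus_neq_zero (u w : vec3) : u <> w -> minus u w <> zero.
Proof.
  intros H E. apply H, vec3_ext. intros c.
  apply (f_equal (coord c)) in E. rewrite coord_minus, coord_zero in E. lra.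
Qed.

Lemma enorm_ge0 u : 0 <= enorm u.
Proof. apply sqrt_pos. Qed.

Lemma enorm_sqr u : enorm u * enorm u = dot u u.
Proof. apply sqrt_sqrt, dot_ge0. Qed.

Lemma enorm_pos (u w : vec3) : u <> w -> 0 < enorm (minus u w).
Proof. intros H. now apply sqrt_lt_R0, dot_gt0, minus_neq_zero. Qed.

Lemma is_derive_pair {U V : NormedModule R_AbsRing} (f : R -> U) (g : R -> V) t df dg :
  is_derive f t df -> is_derive g t dg ->
  is_derive (fun s => (f s, g s)) t (df, dg).
Proof.
  intros [_ Hf] [_ Hg]. split; [apply is_linear_scal_l|].
  intros x Hx. specialize (Hf x Hx). specialize (Hg x Hx). intros eps.
  (* The norm of a product is at most [sqrt 2] times the larger of the norms of the components. *)
  assert (He : 0 < eps / sqrt 2) by (apply Rdiv_lt_0_compat; [apply cond_pos | apply sqrt_lt_R0; lra]).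
  specialize (Hf (mkposreal _ He)). specialize (Hg (mkposreal _ He)).
  generalize (filter_and _ _ Hf Hg). apply filter_imp. simpl. intros y [H1 H2].
  eapply Rle_trans; [apply (norm_prod (K := R_AbsRing) (U := U) (V := V))|].
  simpl.
  set (N := norm (minus y x)) in *.
  assert (HM : Rmax (norm (minus (minus (f y) (f x)) (scal (minus y x) df)))
     (norm (minus (minus (g y) (g x)) (scal (minus y x) dg))) <= eps / sqrt 2 * N)
    by now apply Rmax_lub.
  apply Rle_trans with (sqrt 2 * (eps / sqrt 2 * N)).
  - apply Rmult_le_compat_l; [apply sqrt_pos | exact HM].
  - right. change (sqrt 2 * (eps / sqrt 2 * N) = eps * N).
    field. apply Rgt_not_eq, sqrt_lt_R0; lra.
Qed.

Lemma is_derive_fst {U V : NormedModule R_AbsRing} (f : R -> U * V) t df :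
  is_derive f t df -> is_derive (fun s => fst (f s)) t (fst df).
Proof.
  intros H. eapply filterdiff_ext_lin.
  - apply (filterdiff_comp f fst _ fst H). apply filterdiff_linear, is_linear_fst.
  - now intros y.
Qed.

Lemma is_derive_snd {U V : NormedModule R_AbsRing} (f : R -> U * V) t df :
  is_derive f t df -> is_derive (fun s => snd (f s)) t (snd df).
Proof.
  intros H. eapply filterdiff_ext_lin.
  - apply (filterdiff_comp f snd _ snd H). apply filterdiff_linear, is_linear_snd.
  - now intros y.
Qed.

Lemma is_derive_coord (f : R -> vec3) t df :
  is_derive f t df <-> forall c, is_derive (fun s => coord c (f s)) t (coord c df).
Proof.
  split.
  - intros H c.
    assert (H1 := is_derive_fst f t df H). assert (H2 := is_derive_snd f t df H).
    destruct c; simpl; [now apply (is_derive_fst (fun s => fst (f s))) |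
      now apply (is_derive_snd (fun s => fst (f s))) | exact H2].
  - intros H. destruct df as [[d1 d2] d3].
    apply is_derive_ext with (fun s => (coord axis1 (f s), coord axis2 (f s), coord axis3 (f s))).
    + intros s; now destruct (f s) as [[? ?] ?].
    + apply (is_derive_pair (fun s => (coord axis1 (f s), coord axis2 (f s)))); [|apply (H axis3)].
      apply is_derive_pair; [apply (H axis1) | apply (H axis2)].
Qed.

Lemma filterlim_coord (F : (R -> Prop) -> Prop) {FF : Filter F} (f : R -> vec3) (l : vec3) :
  filterlim f F (locally l) <->
  forall c, filterlim (fun s => coord c (f s)) F (locally (coord c l)).
Proof.
  split.
  - intros H c. apply filterlim_locally; intros eps.
    generalize (proj1 (filterlim_locally _ _) H eps). apply filter_imp.
    intros s [[H1 H2] H3]. now destruct c.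
  - intros H. apply filterlim_locally; intros eps.
    assert (H1 := proj1 (filterlim_locally _ _) (H axis1) eps).
    assert (H2 := proj1 (filterlim_locally _ _) (H axis2) eps).
    assert (H3 := proj1 (filterlim_locally _ _) (H axis3) eps).
    generalize (filter_and _ _ (filter_and _ _ H1 H2) H3). apply filter_imp.
    intros s [[H1' H2'] H3']. now repeat split.
Qed.

Lemma coord_force m x i c :
  coord c (force m x i) =
  sum_bodies (fun j => if body_eq_dec i j then 0 else
    m i * m j / enorm (minus (x j) (x i)) ^ 3 * (coord c (x j) - coord c (x i))).
Proof.
  unfold force, sum_other_bodies, sum_bodies. rewrite !coord_plus.
  repeat match goal with |- context [body_eq_dec ?i ?j] => destruct (body_eq_dec i j) end;
    rewrite ?coord_zero, ?coord_scal, ?coord_minus; reflexivity.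
Qed.

(* A phase-space point is read off its eighteen real coordinates; the boolean
   tells positions ([true]) from velocities ([false]). *)
Definition phase_index : Set := (bool * body * axis)%type.

Definition position (y : phase_index -> R) (i : body) : vec3 :=
  (y (true, i, axis1), y (true, i, axis2), y (true, i, axis3)).

Definition newton_field (m : body -> R) (s : phase_index) (y : phase_index -> R) : R :=
  match s with
  | (true, i, c) => y (false, i, c)
  | (false, i, c) => coord c (force m (position y) i) / m i
  end.

Definition phase (q v : body -> R -> vec3) (t : R) (s : phase_index) : R :=
  match s with (p, i, c) => coord c ((if p then q else v) i t) end.

Lemma phase_index_enum : exists l : list phase_index, forall s, In s l.
Proof.
  exists (list_prod (list_prod (true :: false :: nil) (body1 :: body2 :: body3 :: nil))
    (axis1 :: axis2 :: axis3 :: nil)).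
  intros [[p i] c]. repeat apply in_prod; [destruct p | destruct i | destruct c]; simpl; tauto.
Qed.

Lemma position_phase q v t i : position (phase q v t) i = q i t.
Proof. apply vec3_ext. now intros []. Qed.

Lemma force_ext m x x' i : (forall j, x j = x' j) -> force m x i = force m x' i.
Proof. intros H. unfold force, sum_other_bodies, sum_bodies. now rewrite !H. Qed.

Lemma coord_position c y i : coord c (position y i) = y (true, i, c).
Proof. now destruct c. Qed.

Lemma locally_lipschitz_ext {S : Type} (y0 : S -> R) f g :
  (forall y, f y = g y) -> locally_lipschitz y0 f -> locally_lipschitz y0 g.
Proof.
  intros E (e & L & He & HL & H). exists e, L. repeat split; auto.
  intros y z d Hy Hz Hd. rewrite <- !E. now apply H.
Qed.

(** The field is assembled from coordinates by sums, products, square roots and inverses; the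
    absence of collisions at [y0] supplies the positivity that the last two require. *)
Lemma newton_field_locally_lipschitz m y0 s :
  (forall i j, i <> j -> position y0 i <> position y0 j) ->
  locally_lipschitz y0 (newton_field m s).
Proof.
  intros Hnc. destruct s as [[[|] i] c]; [apply locally_lipschitz_coord|].
  assert (Hd : forall j, i <> j -> locally_lipschitz y0
    (fun y => / enorm (minus (position y j) (position y i)) ^ 3)).
  { intros j Hij.
    assert (Hp := enorm_pos _ _ (not_eq_sym (Hnc i j Hij))).
    apply locally_lipschitz_inv; [now apply pow_lt|].
    assert (He : locally_lipschitz y0 (fun y => enorm (minus (position y j) (position y i)))).
    { unfold enorm. apply locally_lipschitz_sqrt.
      - now apply dot_gt0, minus_neq_zero, not_eq_sym, Hnc.
      - set (d := fun c' (y : phase_index -> R) => y (true, j, c') - y (true, i, c')).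
        apply locally_lipschitz_ext with
          (fun y => d axis1 y * d axis1 y + d axis2 y * d axis2 y + d axis3 y * d axis3 y).
        { intros y. now rewrite dot_coord, !coord_minus, !coord_position. }
        unfold d. repeat first [apply locally_lipschitz_minus
          | apply locally_lipschitz_plus | apply locally_lipschitz_mult | apply locally_lipschitz_coord]. }
    simpl. repeat apply locally_lipschitz_mult; auto. apply locally_lipschitz_const. }
  unfold newton_field, Rdiv. apply locally_lipschitz_mult; [|apply locally_lipschitz_const].
  eapply locally_lipschitz_ext; [intros y; symmetry; apply coord_force|].
  assert (Ht : forall j, locally_lipschitz y0 (fun y => if body_eq_dec i j then 0 else
    m i * m j / enorm (minus (position y j) (position y i)) ^ 3
      * (coord c (position y j) - coord c (position y i)))).
  { intros j. destruct (body_eq_dec i j) as [_|Hij]; [apply locally_lipschitz_const|].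
    apply locally_lipschitz_mult.
    - apply locally_lipschitz_mult; [apply locally_lipschitz_const | auto].
    - apply locally_lipschitz_ext with (fun y : phase_index -> R => y (true, j, c) - y (true, i, c)).
      { intros y. now rewrite !coord_position. }
      apply locally_lipschitz_minus; apply locally_lipschitz_coord. }
  unfold sum_bodies. apply locally_lipschitz_plus; [apply locally_lipschitz_plus|]; apply Ht.
Qed.

(** Translates into the first-order system to which Picard's theorem applies. One direction reads
    off the given orbit, the other certifies its glued extension. *)
Lemma solution_phase m a b q v : (forall i, 0 < m i) ->
  (solution m a b q v <->
   forall t, in_interval a b t ->
     (forall i j, i <> j -> q i t <> q j t) /\
     forall s, is_derive (fun t => phase q v t s) t (newton_field m s (phase q v t))).
Proof.
  intros hm. split.
  - intros H t Ht. destruct (H t Ht) as (Hnc & Hq & Hv). split; auto.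
    intros [[[|] i] c]; simpl.
    + apply is_derive_coord, Hq.
    + destruct (Hv i) as (acc & Hacc & E).
      rewrite (force_ext m _ (fun j => q j t)) by (intros j; apply position_phase).
      rewrite <- E, coord_scal. specialize (hm i).
      apply is_derive_eq with (coord c acc); [field; lra|]. now apply (is_derive_coord (v i)).
  - intros H t Ht. destruct (H t Ht) as (Hnc & Hs). split; [exact Hnc | split].
    + intros i. apply is_derive_coord. intros c. apply (Hs (true, i, c)).
    + intros i. exists (scal (/ m i) (force m (fun j => q j t) i)). split.
      * apply is_derive_coord. intros c. generalize (Hs (false, i, c)). simpl.
        apply is_derive_eq. rewrite coord_scal.
        rewrite (force_ext m _ (fun j => q j t)) by (intros j; apply position_phase).
        unfold Rdiv; ring.
      * apply vec3_ext; intros c. rewrite !coord_scal. specialize (hm i). field. lra.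
Qed.

(** * Extension of solutions *)

Lemma filterlim_locally_R {T : Type} (F : (T -> Prop) -> Prop) {FF : Filter F} (f : T -> R) (l : R) :
  filterlim f F (locally l) <-> forall eps : posreal, F (fun x => Rabs (f x - l) < eps).
Proof. apply (filterlim_locally (U := R_UniformSpace)). Qed.

Lemma filter_forall_list {S T : Type} (F : (T -> Prop) -> Prop) {FF : Filter F} (l : list S) (P : S -> T -> Prop) :
  (forall i, F (P i)) -> F (fun x => forall i, In i l -> P i x).
Proof.
  intros H. induction l as [|i l IH].
  - apply filter_forall. intros x i [].
  - generalize (filter_and _ _ (H i) IH). apply filter_imp. intros x [H1 H2] j [<-|Hj]; auto.
Qed.

Lemma locally_lipschitz_filterlim {S T : Type} (F : (T -> Prop) -> Prop) {FF : Filter F}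
    (l : list S) (y : T -> S -> R) (y0 : S -> R) (g : (S -> R) -> R) :
  (forall i, In i l) -> locally_lipschitz y0 g ->
  (forall i, filterlim (fun x => y x i) F (locally (y0 i))) ->
  filterlim (fun x => g (y x)) F (locally (g y0)).
Proof.
  intros Hl (e & L & He & HL & H) Hy. apply filterlim_locally_R; [exact FF|]. intros eps.
  set (d := Rmin e (eps / (L + 1))).
  assert (He2 : 0 < eps / (L + 1)) by (apply Rdiv_lt_0_compat; [apply cond_pos | lra]).
  assert (Hd : 0 < d) by now apply Rmin_pos.
  assert (HF : F (fun x => forall i, In i l -> Rabs (y x i - y0 i) < d)).
  { apply filter_forall_list; [exact FF|]. intros i.
    apply (proj1 (filterlim_locally_R F _ _) (Hy i) (mkposreal d Hd)). }
  revert HF. apply filter_imp. intros x Hx.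
  assert (Hc : sup_close d (y x) y0) by (intros i; left; auto).
  specialize (H (y x) y0 d (sup_close_weaken _ _ _ _ (Rmin_l _ _) Hc)
    (sup_close_refl _ _ (Rlt_le _ _ He)) Hc).
  eapply Rle_lt_trans; [exact H|].
  assert (Hd2 : d <= eps / (L + 1)) by apply Rmin_r.
  assert (E : (L + 1) * (eps / (L + 1)) = eps) by (field; lra).
  nra.
Qed.

Lemma at_left_interval (b r : R) : 0 < r -> at_left b (fun t => b - r < t < b).
Proof.
  intros Hr. exists (mkposreal r Hr). intros t Ht Htb.
  change (Rabs (t - b) < r) in Ht. apply Rabs_lt_between in Ht. lra.
Qed.

Lemma lipschitz_on_interval (f g : R -> R) (x y K : R) :
  (forall t, x <= t <= y -> is_derive f t (g t) /\ Rabs (g t) <= K) ->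
  x <= y -> Rabs (f y - f x) <= K * (y - x).
Proof.
  intros H Hxy.
  destruct (MVT_gen f x y g) as (c & Hc & E).
  - intros t Ht. rewrite Rmin_left, Rmax_right in Ht by lra. apply H; lra.
  - intros t Ht. rewrite Rmin_left, Rmax_right in Ht by lra.
    apply continuity_pt_filterlim, @ex_derive_continuous. exists (g t). apply H; lra.
  - rewrite Rmin_left, Rmax_right in Hc by lra.
    rewrite E, Rabs_mult, (Rabs_pos_eq (y - x)) by lra.
    apply Rmult_le_compat_r; [lra | now apply H].
Qed.

(** By the mean value theorem [f] is [K]-Lipschitz, so it satisfies the Cauchy criterion at [b]. *)
Lemma bounded_derivative_limit (f g : R -> R) (t0 b K : R) : t0 < b ->
  (forall t, t0 < t < b -> is_derive f t (g t)) ->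
  (forall t, t0 < t < b -> Rabs (g t) <= K) ->
  exists l, filterlim f (at_left b) (locally l).
Proof.
  intros Htb Hd HK.
  assert (HK0 : 0 <= K).
  { eapply Rle_trans; [apply Rabs_pos | apply (HK ((t0 + b) / 2))]. lra. }
  apply (filterlim_locally_cauchy (U := R_CompleteSpace)). intros eps.
  assert (He : 0 < eps / (K + 1)) by (apply Rdiv_lt_0_compat; [apply cond_pos | lra]).
  set (r := Rmin (b - t0) (eps / (K + 1))).
  assert (Hr : 0 < r) by (apply Rmin_pos; lra).
  exists (fun t => b - r < t < b). split; [now apply at_left_interval|].
  assert (Hr1 : r <= b - t0) by apply Rmin_l.
  assert (Hr2 : r <= eps / (K + 1)) by apply Rmin_r.
  assert (E : (K + 1) * (eps / (K + 1)) = eps) by (field; lra).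
  assert (W : forall s t, b - r < s < b -> b - r < t < b -> s <= t -> Rabs (f t - f s) < eps).
  { intros s t Hs Ht Hst.
    apply Rle_lt_trans with (K * (t - s)); [|nra].
    apply lipschitz_on_interval with g; auto. intros x Hx. split; [apply Hd | apply HK]; lra. }
  intros s t Hs Ht. change (Rabs (f t - f s) < eps).
  destruct (Rle_dec s t); [now apply W|]. rewrite Rabs_minus_sym. apply W; auto; lra.
Qed.

(** * Gluing a solution to its continuation *)

Definition glue {V : Type} (b : R) (f h : R -> V) : R -> V :=
  fun t => if Rlt_dec t b then f t else h t.

Lemma glue_left {V : Type} (b : R) (f h : R -> V) t : t < b -> glue b f h t = f t.
Proof. intros H. unfold glue. destruct Rlt_dec; [auto | lra]. Qed.

Lemma glue_right {V : Type} (b : R) (f h : R -> V) t : b <= t -> glue b f h t = h t.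
Proof. intros H. unfold glue. destruct Rlt_dec; [lra | auto]. Qed.

Lemma locally_lt (b t : R) : t < b -> locally t (fun s => s < b).
Proof. intros H. now apply (open_lt b t). Qed.

Lemma locally_gt (b t : R) : b < t -> locally t (fun s => b < s).
Proof. intros H. now apply (open_gt b t). Qed.

Lemma glue_derive_left (f h : R -> R) (b t l : R) : t < b ->
  is_derive f t l -> is_derive (glue b f h) t l.
Proof.
  intros H. apply is_derive_ext_loc. generalize (locally_lt b t H). apply filter_imp.
  intros s Hs. now rewrite glue_left.
Qed.

Lemma glue_derive_right (f h : R -> R) (b t l : R) : b < t ->
  is_derive h t l -> is_derive (glue b f h) t l.
Proof.
  intros H. apply is_derive_ext_loc. generalize (locally_gt b t H). apply filter_imp.
  intros s Hs. rewrite glue_right; lra.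
Qed.

Lemma glue_continuous (f h : R -> R) (b : R) :
  filterlim f (at_left b) (locally (h b)) -> continuous h b -> continuous (glue b f h) b.
Proof.
  intros Hf Hh. unfold continuous. rewrite (glue_right b f h b) by lra.
  apply filterlim_locally_R; [typeclasses eauto|]. intros eps.
  assert (H1 := proj1 (filterlim_locally_R _ _ _) Hf eps).
  assert (H2 := proj1 (filterlim_locally_R _ _ _) Hh eps).
  unfold at_left, within in H1. generalize (filter_and _ _ H1 H2). apply filter_imp.
  intros s [A B]. unfold glue. destruct Rlt_dec; auto.
Qed.

Lemma is_derive_R_eps (f : R -> R) (b l : R) :
  is_derive f b l <->
  forall eps : posreal, locally b (fun t => Rabs (f t - f b - l * (t - b)) <= eps * Rabs (t - b)).
Proof.
  split.
  - intros [_ H] eps. generalize (H b (fun P HP => HP) eps). apply filter_imp. intros t Ht.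
    replace (f t - f b - l * (t - b)) with (f t - f b - (t - b) * l) by ring. exact Ht.
  - intros H. split; [apply is_linear_scal_l|]. intros x Hx.
    assert (E : b = x) by now apply is_filter_lim_locally_unique.
    subst x. intros eps. generalize (H eps). apply filter_imp. intros t Ht.
    replace (f t - f b - l * (t - b)) with (f t - f b - (t - b) * l) in Ht by ring. exact Ht.
Qed.

(** The left derivative at [b] is the limit of [g], by the mean value theorem on [[t, b]]; the right
    derivative is that of [h]. *)
Lemma glue_derive (f g h : R -> R) (b r l : R) : 0 < r ->
  (forall t, b - r < t < b -> is_derive f t (g t)) ->
  filterlim f (at_left b) (locally (h b)) ->
  filterlim g (at_left b) (locally l) ->
  is_derive h b l -> is_derive (glue b f h) b l.
Proof.
  intros Hr Hf Hfb Hg Hh.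
  assert (Hc : continuous (glue b f h) b).
  { apply glue_continuous; auto. apply @ex_derive_continuous. now exists l. }
  apply is_derive_R_eps. intros eps.
  assert (H1 := proj1 (is_derive_R_eps _ _ _) Hh eps).
  assert (H2 := filter_and _ _ (at_left_interval b r Hr) (proj1 (filterlim_locally_R _ _ _) Hg eps)).
  destruct H2 as [d Hd].
  assert (H3 : locally b (fun t => b - d < t)) by (apply locally_gt; destruct d; simpl; lra).
  assert (H4 : locally b (fun t => b - r < t)) by (apply locally_gt; lra).
  generalize (filter_and _ _ H1 (filter_and _ _ H3 H4)). apply filter_imp.
  intros t (Ht1 & Ht3 & Ht4). rewrite (glue_right b f h b) by lra.
  destruct (Rlt_dec t b) as [Htb|Htb]; [|rewrite glue_right by lra; exact Ht1].
  (* The intermediate point ranges over the closed interval and may equal [b], so the candidate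
     derivative is given the value [l] there. *)
  destruct (MVT_gen (glue b f h) t b (glue b g (fun _ => l))) as (c & Hcin & E).
  - rewrite Rmin_left, Rmax_right by lra. intros x Hx.
    rewrite glue_left by lra. apply glue_derive_left; [lra|]. apply Hf; lra.
  - rewrite Rmin_left, Rmax_right by lra. intros x Hx. apply continuity_pt_filterlim.
    destruct (Req_dec x b) as [->|Hxb]; [exact Hc|].
    apply @ex_derive_continuous. exists (g x). apply glue_derive_left; [lra|]. apply Hf; lra.
  - rewrite Rmin_left, Rmax_right in Hcin by lra. rewrite (glue_right b f h b) in E by lra.
    assert (Hcl : Rabs (glue b g (fun _ => l) c - l) <= eps).
    { destruct (Rlt_dec c b) as [Hcb|Hcb].
      - rewrite glue_left by lra.
        assert (B : ball b d c) by (change (Rabs (c - b) < d); apply Rabs_def1; lra).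
        destruct (Hd c B Hcb) as [_ K]. now left.
      - rewrite glue_right, Rminus_eq_0, Rabs_R0 by lra. left; apply cond_pos. }
    replace (glue b f h t - h b - l * (t - b))
      with ((glue b g (fun _ => l) c - l) * (t - b)) by lra.
    rewrite Rabs_mult. apply Rmult_le_compat_r; [apply Rabs_pos | exact Hcl].
Qed.

Lemma glue_phase q v y b t s :
  phase (fun i => glue b (q i) (fun t => position (fun s => y s t) i))
        (fun i => glue b (v i) (fun t => position (fun s => let '(_, j, c) := s in y (false, j, c) t) i)) t s
  = glue b (fun t => phase q v t s) (y s) t.
Proof.
  destruct s as [[[|] i] c]; simpl; unfold glue; destruct Rlt_dec; auto; now destruct c.
Qed.

Lemma newton_field_ext m s y z : (forall r, y r = z r) -> newton_field m s y = newton_field m s z.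
Proof.
  intros H. destruct s as [[[|] i] c]; simpl; [apply H|].
  do 2 f_equal. apply force_ext. intros j. unfold position. now rewrite !H.
Qed.

Lemma noncollision_near (y : phase_index -> R -> R) (b : R) :
  (forall s, continuous (y s) b) ->
  (forall i j, i <> j -> position (fun s => y s b) i <> position (fun s => y s b) j) ->
  locally b (fun t => forall i j, i <> j -> position (fun s => y s t) i <> position (fun s => y s t) j).
Proof.
  intros Hc Hb.
  assert (H : forall i j, i <> j ->
    locally b (fun t => position (fun s => y s t) i <> position (fun s => y s t) j)).
  { intros i j Hij.
    assert (Hex : exists c, y (true, i, c) b <> y (true, j, c) b).
    { destruct (Req_dec (y (true, i, axis1) b) (y (true, j, axis1) b)) as [E1|]; [|now exists axis1].
      destruct (Req_dec (y (true, i, axis2) b) (y (true, j, axis2) b)) as [E2|]; [|now exists axis2].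
      destruct (Req_dec (y (true, i, axis3) b) (y (true, j, axis3) b)) as [E3|]; [|now exists axis3].
      exfalso. apply (Hb i j Hij). unfold position. now rewrite E1, E2, E3. }
    destruct Hex as [c Hcb].
    assert (Hcont : continuous (fun t => y (true, i, c) t - y (true, j, c) t) b)
      by (apply (continuous_minus (y (true, i, c)) (y (true, j, c))); apply Hc).
    assert (Ho := Hcont (fun x => x <> 0) (open_neq 0 _ (Rminus_eq_contra _ _ Hcb))).
    unfold filtermap in Ho. revert Ho. apply filter_imp. intros t Ht E. apply Ht.
    apply (f_equal (coord c)) in E. rewrite !coord_position in E. lra. }
  assert (H' : forall i, locally b (fun t => forall j, In j (body1 :: body2 :: body3 :: nil) -> i <> j ->
    position (fun s => y s t) i <> position (fun s => y s t) j)).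
  { intros i. apply (filter_forall_list (locally b) _ (fun j t => i <> j ->
      position (fun s => y s t) i <> position (fun s => y s t) j)).
    intros j. destruct (body_eq_dec i j) as [E|E].
    - apply filter_forall. tauto.
    - generalize (H i j E). apply filter_imp. auto. }
  assert (H'' := filter_forall_list (locally b) (body1 :: body2 :: body3 :: nil) _ H').
  revert H''. apply filter_imp. intros t Ht i j.
  apply Ht; [destruct i | destruct j]; simpl; tauto.
Qed.

(** The limits form a noncollision state. The Picard solution that starts there at time [b], glued
    to the orbit, solves the equations on a strictly larger interval. *)
Lemma not_maximal_of_limits m a (b : R) q v (c u : body -> vec3) :
  (forall i, 0 < m i) -> Rbar_lt a b ->
  (forall i, filterlim (q i) (at_left b) (locally (c i))) ->
  (forall i, filterlim (v i) (at_left b) (locally (u i))) ->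
  (forall i j, i <> j -> c i <> c j) ->
  ~ maximal_solution m a b q v.
Proof.
  intros hm Hab Hq Hv Hnc [Hsol Hmax].
  set (y0 := fun s : phase_index => let '(p, i, x) := s in coord x ((if p then c else u) i)).
  destruct phase_index_enum as [l Hl].
  assert (Hpos0 : forall i, position y0 i = c i) by (intros i; now apply vec3_ext; intros []).
  assert (Hlip : forall s, locally_lipschitz y0 (newton_field m s)).
  { intros s. apply newton_field_locally_lipschitz. intros i j Hij. rewrite !Hpos0. auto. }
  destruct (picard_local l (newton_field m) y0 b Hl Hlip) as (tau & y & Htau & Hyb & Hy).
  assert (Hlim : forall s, filterlim (fun t => phase q v t s) (at_left b) (locally (y0 s))).
  { intros [[p i] x]. simpl. destruct p; [apply (proj1 (filterlim_coord _ _ _) (Hq i))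
      | apply (proj1 (filterlim_coord _ _ _) (Hv i))]. }
  assert (Hbb : Rabs (b - b) < tau) by (rewrite Rminus_eq_0, Rabs_R0; auto).
  destruct (noncollision_near y b) as [r Hr].
  { intros s. apply @ex_derive_continuous. eexists. now apply Hy. }
  { intros i j Hij. replace (position (fun s => y s b) i) with (c i).
    replace (position (fun s => y s b) j) with (c j). now apply Hnc.
    all: apply vec3_ext; intros x; rewrite coord_position, Hyb; reflexivity. }
  (* Within [e] of [b] the Picard solution both exists and is free of collisions. *)
  set (e := Rmin tau r).
  assert (He : 0 < e) by (apply Rmin_pos; [auto | apply cond_pos]).
  assert (He1 : e <= tau) by apply Rmin_l. assert (He2 : e <= r) by apply Rmin_r.
  set (q' := fun i => glue b (q i) (fun t => position (fun s => y s t) i)).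
  set (v' := fun i => glue b (v i) (fun t => position (fun s => let '(_, j, c) := s in y (false, j, c) t) i)).
  destruct (Hmax a (b + e) q' v') as [_ E].
  - apply Rbar_le_refl.
  - simpl; lra.
  - apply solution_phase; auto. rewrite solution_phase in Hsol by auto.
    assert (Hleft : exists d, 0 < d /\ forall t, b - d < t < b -> in_interval a b t).
    { destruct a as [a| |]; simpl in Hab; try contradiction.
      - exists (b - a). split; [lra|]. intros t Ht. split; simpl; lra.
      - exists 1. split; [lra|]. intros t Ht. split; simpl; lra || auto. }
    destruct Hleft as (d & Hd & Hleft).
    intros t [Hat Htb]. simpl in Htb.
    assert (Hext : forall s, is_derive (glue b (fun t => phase q v t s) (y s)) t
      (newton_field m s (phase q' v' t)) ->
      is_derive (fun t => phase q' v' t s) t (newton_field m s (phase q' v' t))).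
    { intros s. apply is_derive_ext. intros x. symmetry. apply glue_phase. }
    destruct (total_order_T t b) as [[Hlt|Heq]|Hgt].
    + destruct (Hsol t) as [Hn Hs]; [split; auto|]. split.
      * intros i j Hij. unfold q'. rewrite !glue_left by auto. now apply Hn.
      * intros s. apply Hext, glue_derive_left; auto.
        rewrite (newton_field_ext m s _ (phase q v t)); [apply Hs|].
        intros x. unfold q', v'. now rewrite glue_phase, glue_left.
    + subst t. split.
      * intros i j Hij. unfold q'. rewrite !glue_right by lra.
        apply (Hr b); auto. apply ball_center.
      * intros s. apply Hext.
        rewrite (newton_field_ext m s _ y0)
          by (intros x; unfold q', v'; rewrite glue_phase, glue_right by lra; apply Hyb).
        (* At the seam, continuity of the field at [y0] makes the derivatives of the orbit converge
           to the derivative of the Picard solution. *)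
        apply glue_derive with (g := fun t => newton_field m s (phase q v t)) (r := d); auto.
        -- intros t Ht. now apply Hsol, Hleft.
        -- rewrite Hyb. apply Hlim.
        -- apply (locally_lipschitz_filterlim (at_left b) l (phase q v) y0); auto.
        -- rewrite <- (newton_field_ext m s (fun x => y x b) y0) by auto. now apply Hy.
    + split.
      * intros i j Hij. unfold q'. rewrite !glue_right by lra.
        apply (Hr t); auto. change (Rabs (t - b) < r). apply Rabs_def1; lra.
      * intros s. apply Hext, glue_derive_right; auto.
        rewrite (newton_field_ext m s _ (fun x => y x t))
          by (intros x; unfold q', v'; rewrite glue_phase, glue_right by lra; auto).
        apply Hy. apply Rabs_def1; lra.
  - intros i t [_ Ht]. unfold q'. now apply glue_left.
  - injection E. lra.
Qed.

(** * Conservation laws *)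

Definition acceleration (m : body -> R) (x : body -> vec3) (i : body) : vec3 :=
  scal (/ m i) (force m x i).

Lemma is_derive_Rplus (f g : R -> R) t df dg :
  is_derive f t df -> is_derive g t dg -> is_derive (fun s => f s + g s) t (df + dg).
Proof. exact (is_derive_plus f g t df dg). Qed.

Lemma is_derive_Rminus (f g : R -> R) t df dg :
  is_derive f t df -> is_derive g t dg -> is_derive (fun s => f s - g s) t (df - dg).
Proof. exact (is_derive_minus f g t df dg). Qed.

Lemma is_derive_dot (f g : R -> vec3) t df dg :
  is_derive f t df -> is_derive g t dg ->
  is_derive (fun s => dot (f s) (g s)) t (dot df (g t) + dot (f t) dg).
Proof.
  intros Hf Hg. rewrite is_derive_coord in Hf. rewrite is_derive_coord in Hg.
  apply is_derive_ext with (fun s => coord axis1 (f s) * coord axis1 (g s)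
    + coord axis2 (f s) * coord axis2 (g s) + coord axis3 (f s) * coord axis3 (g s)).
  { intros s. symmetry. apply dot_coord. }
  eapply is_derive_eq; cycle 1.
  - exact (is_derive_Rplus _ _ _ _ _ (is_derive_Rplus _ _ _ _ _
      (Derive.is_derive_mult _ _ _ _ _ (Hf axis1) (Hg axis1))
      (Derive.is_derive_mult _ _ _ _ _ (Hf axis2) (Hg axis2)))
      (Derive.is_derive_mult _ _ _ _ _ (Hf axis3) (Hg axis3))).
  - rewrite !dot_coord. ring.
Qed.

Lemma enorm_gt0 u : u <> zero -> 0 < enorm u.
Proof. intros H. now apply sqrt_lt_R0, dot_gt0. Qed.

Lemma is_derive_enorm (f : R -> vec3) t df : f t <> zero ->
  is_derive f t df -> is_derive (fun s => enorm (f s)) t (dot (f t) df / enorm (f t)).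
Proof.
  intros Hn Hf. assert (Hp := enorm_gt0 _ Hn). unfold enorm in *.
  eapply is_derive_eq; cycle 1.
  - apply is_derive_sqrt; [apply is_derive_dot; eassumption | now apply dot_gt0].
  - rewrite !dot_coord in *. field. lra.
Qed.

Lemma enorm_minus_sym u w : enorm (minus u w) = enorm (minus w u).
Proof. unfold enorm. f_equal. rewrite !dot_coord, !coord_minus. ring. Qed.

Definition newton_at (m : body -> R) (q v : body -> R -> vec3) (t : R) : Prop :=
  (forall i j, i <> j -> q i t <> q j t) /\
  (forall i, is_derive (q i) t (v i t)) /\
  (forall i, is_derive (v i) t (acceleration m (fun j => q j t) i)).

Lemma solution_newton_at m a b q v t : (forall i, 0 < m i) ->
  solution m a b q v -> in_interval a b t -> newton_at m q v t.
Proof.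
  intros hm Hs Ht. destruct (Hs t Ht) as (Hn & Hq & Hv). split; [exact Hn | split; [exact Hq|]].
  intros i. destruct (Hv i) as (acc & Hacc & E). specialize (hm i).
  replace (acceleration m (fun j => q j t) i) with acc; [exact Hacc|].
  unfold acceleration. rewrite <- E. apply vec3_ext; intros c. rewrite !coord_scal. field. lra.
Qed.

Lemma interval_constant (a b : Rbar) (f : R -> R) s t :
  (forall x, in_interval a b x -> is_derive f x 0) ->
  in_interval a b s -> in_interval a b t -> f s = f t.
Proof.
  intros Hd.
  assert (W : forall s t, s < t -> in_interval a b s -> in_interval a b t -> f s = f t).
  { clear s t. intros s t Hst [Hs _] [_ Ht]. apply (eq_is_derive f); [|exact Hst].
    intros x Hx. apply Hd. split.
    - apply Rbar_lt_le_trans with s; simpl; tauto.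
    - apply Rbar_le_lt_trans with t; simpl; tauto. }
  intros Hs Ht. destruct (total_order_T s t) as [[H|H]|H]; [auto | now subst | symmetry; auto].
Qed.

Lemma coord_cross c (u w : vec3) :
  coord c (cross u w) =
  match c with
  | axis1 => coord axis2 u * coord axis3 w - coord axis3 u * coord axis2 w
  | axis2 => coord axis3 u * coord axis1 w - coord axis1 u * coord axis3 w
  | axis3 => coord axis1 u * coord axis2 w - coord axis2 u * coord axis1 w
  end.
Proof. destruct u as [[? ?] ?], w as [[? ?] ?]. now destruct c. Qed.

Lemma coord_sum_bodies c (f : body -> vec3) :
  coord c (sum_bodies f) = sum_bodies (fun i => coord c (f i)).
Proof. unfold sum_bodies. now rewrite !coord_plus. Qed.

Lemma is_derive_sum_bodies (f : body -> R -> R) t (df : body -> R) :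
  (forall i, is_derive (f i) t (df i)) ->
  is_derive (fun s => sum_bodies (fun i => f i s)) t (sum_bodies df).
Proof.
  intros H. unfold sum_bodies.
  apply (is_derive_plus (fun s => plus (f body1 s) (f body2 s)) (f body3)); [|apply H].
  now apply (is_derive_plus (f body1) (f body2)).
Qed.

Lemma coord_acceleration m x i c :
  coord c (acceleration m x i) = / m i * coord c (force m x i).
Proof. apply coord_scal. Qed.

Lemma sum_bodies_distinct (i j k : body) (f : body -> R) :
  i <> j -> i <> k -> j <> k -> sum_bodies f = f i + f j + f k.
Proof.
  intros. unfold sum_bodies, plus; simpl. destruct i, j, k; try congruence; ring.
Qed.

Lemma coord_force_distinct m x (i j k : body) c : i <> j -> i <> k -> j <> k ->
  coord c (force m x i) =
  m i * m j / enorm (minus (x i) (x j)) ^ 3 * (coord c (x j) - coord c (x i)) +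
  m i * m k / enorm (minus (x i) (x k)) ^ 3 * (coord c (x k) - coord c (x i)).
Proof.
  intros Hij Hik Hjk. rewrite coord_force, (sum_bodies_distinct i j k) by auto.
  rewrite (enorm_minus_sym (x i) (x j)), (enorm_minus_sym (x i) (x k)).
  destruct (body_eq_dec i i) as [_|N]; [|now contradict N].
  destruct (body_eq_dec i j) as [N|_]; [contradiction|].
  destruct (body_eq_dec i k) as [N|_]; [contradiction|]. ring.
Qed.

Ltac expand_forces m q t :=
  rewrite ?(coord_force_distinct m (fun j => q j t) body1 body2 body3),
    ?(coord_force_distinct m (fun j => q j t) body2 body1 body3),
    ?(coord_force_distinct m (fun j => q j t) body3 body1 body2) by discriminate;
  rewrite ?(enorm_minus_sym (q body2 t) (q body1 t)), ?(enorm_minus_sym (q body3 t) (q body1 t)),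
    ?(enorm_minus_sym (q body3 t) (q body2 t)).

(** Mutual forces are opposite and cancel in pairs. *)
Lemma momentum_derivative m q v t c : (forall i, 0 < m i) -> newton_at m q v t ->
  is_derive (fun t => coord c (sum_bodies (fun i => scal (m i) (v i t)))) t 0.
Proof.
  intros hm (Hn & Hq & Hv).
  apply is_derive_ext with (fun t => sum_bodies (fun i => m i * coord c (v i t))).
  { intros s. rewrite coord_sum_bodies. unfold sum_bodies. now rewrite !coord_scal. }
  eapply is_derive_eq; cycle 1.
  - apply (is_derive_sum_bodies (fun i t => m i * coord c (v i t))). intros i.
    apply is_derive_scal. apply is_derive_coord, Hv.
  - rewrite (sum_bodies_distinct body1 body2 body3), !coord_acceleration by discriminate.
    expand_forces m q t.
    assert (H1 := hm body1). assert (H2 := hm body2). assert (H3 := hm body3).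
    assert (N1 := enorm_pos _ _ (Hn body1 body2 ltac:(discriminate))).
    assert (N2 := enorm_pos _ _ (Hn body1 body3 ltac:(discriminate))).
    assert (N3 := enorm_pos _ _ (Hn body2 body3 ltac:(discriminate))).
    field. repeat split; lra.
Qed.

Lemma center_derivative m q v t c : newton_at m q v t ->
  is_derive (fun t => coord c (sum_bodies (fun i => scal (m i) (q i t)))) t
    (coord c (sum_bodies (fun i => scal (m i) (v i t)))).
Proof.
  intros (Hn & Hq & Hv).
  apply is_derive_ext with (fun t => sum_bodies (fun i => m i * coord c (q i t))).
  { intros s. rewrite coord_sum_bodies. unfold sum_bodies. now rewrite !coord_scal. }
  eapply is_derive_eq; cycle 1.
  - apply (is_derive_sum_bodies (fun i t => m i * coord c (q i t))). intros i.
    apply is_derive_scal. apply is_derive_coord, Hq.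
  - rewrite coord_sum_bodies. unfold sum_bodies. now rewrite !coord_scal.
Qed.

(** The terms [v x v] vanish, and the torques of each pair cancel because the forces are directed
    along the line joining the bodies. *)
Lemma angular_momentum_derivative m q v t c : (forall i, 0 < m i) -> newton_at m q v t ->
  is_derive (fun t => coord c (angular_momentum m (fun i => q i t) (fun i => v i t))) t 0.
Proof.
  intros hm (Hn & Hq & Hv).
  assert (Dq : forall i c, is_derive (fun t => coord c (q i t)) t (coord c (v i t)))
    by (intros i c'; apply is_derive_coord, Hq).
  assert (Dv : forall i c, is_derive (fun t => coord c (v i t)) t (coord c (acceleration m (fun j => q j t) i)))
    by (intros i c'; apply is_derive_coord, Hv).
  apply is_derive_ext with (fun t => sum_bodies (fun i => m i * coord c (cross (q i t) (v i t)))).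
  { intros s. unfold angular_momentum. rewrite coord_sum_bodies. unfold sum_bodies. now rewrite !coord_scal. }
  assert (Dc : forall i, is_derive (fun t => coord c (cross (q i t) (v i t))) t
    (coord c (cross (q i t) (acceleration m (fun j => q j t) i)))).
  { intros i.
    assert (W : forall c1 c2, is_derive
      (fun t => coord c1 (q i t) * coord c2 (v i t) - coord c2 (q i t) * coord c1 (v i t)) t
      (coord c1 (q i t) * coord c2 (acceleration m (fun j => q j t) i)
        - coord c2 (q i t) * coord c1 (acceleration m (fun j => q j t) i))).
    { intros c1 c2. eapply is_derive_eq; cycle 1.
      - exact (is_derive_Rminus _ _ _ _ _
          (Derive.is_derive_mult _ _ _ _ _ (Dq i c1) (Dv i c2))
          (Derive.is_derive_mult _ _ _ _ _ (Dq i c2) (Dv i c1))).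
      - cbv beta; ring. }
    eapply is_derive_ext; [intros s; symmetry; apply coord_cross|].
    rewrite coord_cross. destruct c; apply W. }
  eapply is_derive_eq; cycle 1.
  - apply (is_derive_sum_bodies (fun i t => m i * coord c (cross (q i t) (v i t)))). intros i.
    apply is_derive_scal. apply Dc.
  - rewrite (sum_bodies_distinct body1 body2 body3), !coord_cross by discriminate.
    assert (H1 := hm body1). assert (H2 := hm body2). assert (H3 := hm body3).
    assert (N1 := enorm_pos _ _ (Hn body1 body2 ltac:(discriminate))).
    assert (N2 := enorm_pos _ _ (Hn body1 body3 ltac:(discriminate))).
    assert (N3 := enorm_pos _ _ (Hn body2 body3 ltac:(discriminate))).
    destruct c; rewrite !coord_acceleration; expand_forces m q t; field; repeat split; lra.
Qed.

Lemma is_derive_inv_distance m q v t i j : newton_at m q v t -> i <> j ->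
  is_derive (fun t => / enorm (minus (q i t) (q j t))) t
    (- dot (minus (q i t) (q j t)) (minus (v i t) (v j t)) / enorm (minus (q i t) (q j t)) ^ 3).
Proof.
  intros (Hn & Hq & Hv).
  intros Hij. assert (Hz := minus_neq_zero _ _ (Hn i j Hij)). assert (Hp := enorm_gt0 _ Hz).
  eapply is_derive_eq; cycle 1.
  - apply is_derive_inv; [|lra].
    apply (is_derive_enorm (fun s => minus (q i s) (q j s)) t (minus (v i t) (v j t)) Hz).
    exact (is_derive_minus (q i) (q j) t _ _ (Hq i) (Hq j)).
  - cbv beta. field. lra.
Qed.

(** The power of the forces, which is the derivative of the kinetic energy, equals the derivative of
    the sum of the [m_i m_j / |q_i - q_j|]. *)
Lemma energy_derivative m q v t : (forall i, 0 < m i) -> newton_at m q v t ->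
  is_derive (fun t => energy m (fun i => q i t) (fun i => v i t)) t 0.
Proof.
  intros hm (Hn & Hq & Hv).
  apply is_derive_ext with (fun t => / 2 * sum_bodies (fun i => m i * dot (v i t) (v i t))
    - (m body1 * m body2 * / enorm (minus (q body1 t) (q body2 t))
     + m body1 * m body3 * / enorm (minus (q body1 t) (q body3 t))
     + m body2 * m body3 * / enorm (minus (q body2 t) (q body3 t)))).
  { intros s. unfold energy, sum_bodies. rewrite <- !enorm_sqr. simpl. unfold Rdiv.
    rewrite !Rmult_1_r. reflexivity. }
  assert (Dk : forall i, is_derive (fun t => m i * dot (v i t) (v i t)) t
    (2 * dot (v i t) (force m (fun j => q j t) i))).
  { intros i. eapply is_derive_eq; cycle 1.
    - apply is_derive_scal, is_derive_dot; apply Hv.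
    - specialize (hm i). rewrite !dot_coord, !coord_acceleration. field. lra. }
  eapply is_derive_eq; cycle 1.
  - apply is_derive_Rminus.
    + apply is_derive_scal. apply (is_derive_sum_bodies (fun i t => m i * dot (v i t) (v i t))), Dk.
    + apply is_derive_Rplus; [apply is_derive_Rplus|];
        apply is_derive_scal; apply (is_derive_inv_distance m q v t); (discriminate || easy).
  - rewrite (sum_bodies_distinct body1 body2 body3) by discriminate.
    rewrite !dot_coord, !coord_minus. expand_forces m q t.
    assert (N1 := enorm_pos _ _ (Hn body1 body2 ltac:(discriminate))).
    assert (N2 := enorm_pos _ _ (Hn body1 body3 ltac:(discriminate))).
    assert (N3 := enorm_pos _ _ (Hn body2 body3 ltac:(discriminate))).
    field. repeat split; lra.
Qed.
Lemma conservation_laws m a b q v H J : (forall i, 0 < m i) ->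
  solution m a b q v -> in_interval a b 0 ->
  centered m (fun i => q i 0) -> zero_momentum m (fun i => v i 0) ->
  energy m (fun i => q i 0) (fun i => v i 0) = H ->
  angular_momentum m (fun i => q i 0) (fun i => v i 0) = J ->
  forall t, in_interval a b t ->
    centered m (fun i => q i t) /\ zero_momentum m (fun i => v i t) /\
    energy m (fun i => q i t) (fun i => v i t) = H /\
    angular_momentum m (fun i => q i t) (fun i => v i t) = J.
Proof.
  intros hm Hs H0 Hc Hp HE HJ.
  (* Momentum has to come before the centre of mass, whose derivative it is. *)
  assert (Hmom : forall t, in_interval a b t -> zero_momentum m (fun i => v i t)).
  { intros t Ht. unfold zero_momentum in *. rewrite <- Hp. apply vec3_ext; intros c.
    apply (interval_constant a b (fun t => coord c (sum_bodies (fun i => scal (m i) (v i t))))); auto.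
    intros x Hx. assert (D := solution_newton_at m a b q v x hm Hs Hx).
    now apply momentum_derivative with q. }
  intros t Ht. split; [|split; [auto | split]].
  - unfold centered in *. rewrite <- Hc. apply vec3_ext; intros c.
    apply (interval_constant a b (fun t => coord c (sum_bodies (fun i => scal (m i) (q i t))))); auto.
    intros x Hx. assert (D := solution_newton_at m a b q v x hm Hs Hx).
    apply is_derive_eq with (coord c (sum_bodies (fun i => scal (m i) (v i x)))).
    + rewrite (Hmom x Hx). apply coord_zero.
    + now apply center_derivative.
  - rewrite <- HE.
    apply (interval_constant a b (fun t => energy m (fun i => q i t) (fun i => v i t))); auto.
    intros x Hx. assert (D := solution_newton_at m a b q v x hm Hs Hx).
    now apply energy_derivative.
  - rewrite <- HJ. apply vec3_ext; intros c.
    apply (interval_constant a b (fun t => coord c (angular_momentum m (fun i => q i t) (fun i => v i t)))); auto.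
    intros x Hx. assert (D := solution_newton_at m a b q v x hm Hs Hx).
    now apply angular_momentum_derivative.
Qed.

(** * Orbits with a tight pair *)

Lemma coord_le_enorm c u : Rabs (coord c u) <= enorm u.
Proof.
  rewrite <- sqrt_Rsqr_abs. apply sqrt_le_1_alt. unfold Rsqr. rewrite dot_coord.
  destruct c; nra.
Qed.

Lemma force_term_bound (e u A d : R) :
  0 < d -> d <= e -> 0 <= A -> Rabs u <= e -> Rabs (A / e ^ 3 * u) <= A / d ^ 2.
Proof.
  intros Hd Hde HA Hu.
  assert (He3 : 0 < e ^ 3) by (apply pow_lt; lra).
  assert (Hd2 : 0 < d ^ 2) by (apply pow_lt; lra).
  rewrite Rabs_mult, (Rabs_pos_eq (A / e ^ 3)) by (apply Rdiv_le_0_compat; auto).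
  apply Rle_trans with (A / e ^ 3 * e).
  - apply Rmult_le_compat_l; auto. apply Rdiv_le_0_compat; auto.
  - replace (A / e ^ 3 * e) with (A * / e ^ 2) by (field; lra).
    apply Rmult_le_compat_l; auto. apply Rinv_le_contravar; auto. apply pow_incr; lra.
Qed.

Lemma coord_force_bound m x (i j k : body) c d : (forall i, 0 < m i) ->
  i <> j -> i <> k -> j <> k -> 0 < d ->
  d <= enorm (minus (x i) (x j)) -> d <= enorm (minus (x i) (x k)) ->
  Rabs (coord c (force m x i)) <= m i * m j / d ^ 2 + m i * m k / d ^ 2.
Proof.
  intros hm Hij Hik Hjk Hd Hj Hk. rewrite (coord_force_distinct m x i j k c) by auto.
  eapply Rle_trans; [apply Rabs_triang|].
  assert (P : forall l, 0 <= m i * m l) by (intros l; generalize (hm i) (hm l); nra).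
  apply Rplus_le_compat; apply force_term_bound; auto;
    rewrite <- coord_minus, enorm_minus_sym; apply coord_le_enorm.
Qed.

Lemma in_interval_between (a b : Rbar) s t x :
  in_interval a b s -> in_interval a b t -> s <= x <= t -> in_interval a b x.
Proof.
  intros [Hs _] [_ Ht] Hx. split.
  - apply Rbar_lt_le_trans with s; simpl; tauto.
  - apply Rbar_le_lt_trans with t; simpl; tauto.
Qed.

Lemma in_interval_right (a : Rbar) (b s x : R) :
  in_interval a b s -> s <= x < b -> in_interval a b x.
Proof.
  intros [Hs _] Hx. split; [|simpl; tauto]. apply Rbar_lt_le_trans with s; simpl; tauto.
Qed.

(** On a bounded interval the bound on [h] also bounds [g], so both [f] and [g] have bounded
    derivatives. *)
Lemma bounded_second_derivative_limits (f g h : R -> R) (t0 b K : R) : t0 < b ->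
  (forall t, t0 <= t < b -> is_derive f t (g t) /\ is_derive g t (h t) /\ Rabs (h t) <= K) ->
  (exists l, filterlim f (at_left b) (locally l)) /\
  (exists l, filterlim g (at_left b) (locally l)).
Proof.
  intros Htb H.
  assert (HK : 0 <= K) by (eapply Rle_trans; [apply Rabs_pos | apply (H t0); lra]).
  split.
  - apply bounded_derivative_limit with g t0 (Rabs (g t0) + K * (b - t0)); auto.
    + intros t Ht. apply H; lra.
    + intros t Ht.
      assert (Hl : Rabs (g t - g t0) <= K * (t - t0)).
      { apply lipschitz_on_interval with h; [|lra]. intros s Hs.
        destruct (H s) as (_ & H2 & H3); [lra|]. auto. }
      replace (g t) with (g t0 + (g t - g t0)) by ring.
      eapply Rle_trans; [apply Rabs_triang|]. nra.
  - apply bounded_derivative_limit with h t0 K; auto; intros t Ht; apply H; lra.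
Qed.

Lemma choose_vec3 (P : axis -> R -> Prop) :
  (forall c, exists l, P c l) -> exists u : vec3, forall c, P c (coord c u).
Proof.
  intros H. destruct (H axis1) as [l1 H1], (H axis2) as [l2 H2], (H axis3) as [l3 H3].
  exists (l1, l2, l3). now intros [].
Qed.

Lemma choose_body {T : Type} (P : body -> T -> Prop) :
  (forall i, exists u, P i u) -> exists f, forall i, P i (f i).
Proof.
  intros H. destruct (H body1) as [u1 H1], (H body2) as [u2 H2], (H body3) as [u3 H3].
  exists (fun i => match i with body1 => u1 | body2 => u2 | body3 => u3 end). now intros [].
Qed.

(** A body away from the other two feels a bounded force, whatever those two do to each other. It is
    applied to the outer body alone and, away from all collisions, to each body. *)
Lemma separated_body_limits m a (b : R) q v (i j k : body) t0 d : (forall i, 0 < m i) ->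
  solution m a b q v -> in_interval a b t0 -> i <> j -> i <> k -> j <> k -> 0 < d ->
  (forall t, t0 <= t < b ->
    d <= enorm (minus (q i t) (q j t)) /\ d <= enorm (minus (q i t) (q k t))) ->
  (exists c, filterlim (q i) (at_left b) (locally c)) /\
  (exists u, filterlim (v i) (at_left b) (locally u)).
Proof.
  intros hm Hs Ht0 Hij Hik Hjk Hd Hsep.
  assert (Hb : t0 < b) by apply Ht0.
  assert (Hc : forall c,
    (exists l, filterlim (fun t => coord c (q i t)) (at_left b) (locally l)) /\
    (exists l, filterlim (fun t => coord c (v i t)) (at_left b) (locally l))).
  { intros c. apply bounded_second_derivative_limits with
      (h := fun t => coord c (acceleration m (fun j => q j t) i)) (t0 := t0)
      (K := / m i * (m i * m j / d ^ 2 + m i * m k / d ^ 2)); auto.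
    intros t Ht. assert (Hin := in_interval_right a b t0 t Ht0 Ht).
    destruct (solution_newton_at m a b q v t hm Hs Hin) as (_ & Hq & Hv).
    split; [apply is_derive_coord, Hq | split; [apply is_derive_coord, Hv|]].
    rewrite coord_acceleration, Rabs_mult, Rabs_pos_eq by (left; apply Rinv_0_lt_compat, hm).
    apply Rmult_le_compat_l; [left; apply Rinv_0_lt_compat, hm|].
    destruct (Hsep t Ht). now apply (coord_force_bound m (fun j => q j t) i j k). }
  split.
  - destruct (choose_vec3 _ (fun c => proj1 (Hc c))) as [u Hu]. exists u.
    apply (filterlim_coord (at_left b) (q i)), Hu.
  - destruct (choose_vec3 _ (fun c => proj2 (Hc c))) as [u Hu]. exists u.
    apply (filterlim_coord (at_left b) (v i)), Hu.
Qed.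

Lemma filterlim_Rplus {T} (F : (T -> Prop) -> Prop) {FF : Filter F} (f g : T -> R) l l' :
  filterlim f F (locally l) -> filterlim g F (locally l') ->
  filterlim (fun x => f x + g x) F (locally (l + l')).
Proof. intros Hf Hg. exact (filterlim_comp_2 f g Rplus Hf Hg (filterlim_plus l l')). Qed.

Lemma filterlim_Rmult {T} (F : (T -> Prop) -> Prop) {FF : Filter F} (f g : T -> R) l l' :
  filterlim f F (locally l) -> filterlim g F (locally l') ->
  filterlim (fun x => f x * g x) F (locally (l * l')).
Proof. intros Hf Hg. exact (filterlim_comp_2 f g Rmult Hf Hg (filterlim_mult l l')). Qed.

Lemma filterlim_Rscal {T} (F : (T -> Prop) -> Prop) {FF : Filter F} (k : R) (f : T -> R) l :
  filterlim f F (locally l) -> filterlim (fun x => k * f x) F (locally (k * l)).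
Proof. intros Hf. apply filterlim_Rmult; auto. apply filterlim_const. Qed.

Lemma filterlim_dot {T} (F : (T -> Prop) -> Prop) {FF : Filter F} (f g : T -> vec3) l l' :
  (forall c, filterlim (fun x => coord c (f x)) F (locally (coord c l))) ->
  (forall c, filterlim (fun x => coord c (g x)) F (locally (coord c l'))) ->
  filterlim (fun x => dot (f x) (g x)) F (locally (dot l l')).
Proof.
  intros Hf Hg. rewrite dot_coord.
  apply filterlim_ext with (fun x => coord axis1 (f x) * coord axis1 (g x)
    + coord axis2 (f x) * coord axis2 (g x) + coord axis3 (f x) * coord axis3 (g x)).
  { intros x. symmetry. apply dot_coord. }
  apply filterlim_Rplus; auto; [apply filterlim_Rplus; auto|]; apply filterlim_Rmult; auto.
Qed.

Lemma filterlim_coord_minus {T} (F : (T -> Prop) -> Prop) {FF : Filter F} (f g : T -> vec3) l l' c :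
  filterlim (fun x => coord c (f x)) F (locally (coord c l)) ->
  filterlim (fun x => coord c (g x)) F (locally (coord c l')) ->
  filterlim (fun x => coord c (minus (f x) (g x))) F (locally (coord c (minus l l'))).
Proof.
  intros Hf Hg. rewrite coord_minus.
  apply filterlim_ext with (fun x => coord c (f x) + -1 * coord c (g x)).
  { intros x. rewrite coord_minus. ring. }
  replace (coord c l - coord c l') with (coord c l + -1 * coord c l') by ring.
  apply filterlim_Rplus; auto. now apply filterlim_Rscal.
Qed.

(** If the limits coincided, the squared distance would tend to zero. *)
Lemma limit_separated (b d : R) (f g : R -> vec3) (l l' : vec3) : 0 < d ->
  filterlim f (at_left b) (locally l) -> filterlim g (at_left b) (locally l') ->
  at_left b (fun t => d <= enorm (minus (f t) (g t))) -> l <> l'.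
Proof.
  intros Hd Hf Hg Hsep E. subst l'.
  assert (Hl : filterlim (fun t => dot (minus (f t) (g t)) (minus (f t) (g t))) (at_left b)
    (locally (dot (minus l l) (minus l l)))).
  { apply filterlim_dot; [typeclasses eauto| |];
      intros c; apply filterlim_coord_minus; try typeclasses eauto;
      first [apply (proj1 (filterlim_coord _ _ _) Hf) | apply (proj1 (filterlim_coord _ _ _) Hg)]. }
  replace (dot (minus l l) (minus l l)) with 0 in Hl
    by (rewrite dot_coord, !coord_minus; ring).
  assert (Hd2 : 0 < d * d) by nra.
  assert (H := proj1 (filterlim_locally_R _ _ _) Hl (mkposreal _ Hd2)).
  destruct (filter_ex (F := at_left b) _ (filter_and _ _ H Hsep)) as (t & H1 & H2).
  cbn [pos] in H1. cbv beta in H1.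
  rewrite Rminus_0_r, Rabs_pos_eq, <- enorm_sqr in H1 by apply dot_ge0. nra.
Qed.

Lemma separated_not_maximal m a (b : R) q v t0 d : (forall i, 0 < m i) ->
  in_interval a b t0 -> 0 < d ->
  (forall t i j, t0 <= t < b -> i <> j -> d <= enorm (minus (q i t) (q j t))) ->
  ~ maximal_solution m a b q v.
Proof.
  intros hm Ht0 Hd Hsep Hmax. assert (Hs := proj1 Hmax).
  assert (Hlim : forall i, (exists c, filterlim (q i) (at_left b) (locally c)) /\
    (exists u, filterlim (v i) (at_left b) (locally u))).
  { assert (W : forall i j k, i <> j -> i <> k -> j <> k ->
      (exists c, filterlim (q i) (at_left b) (locally c)) /\
      (exists u, filterlim (v i) (at_left b) (locally u))).
    { intros i j k Hij Hik Hjk. apply separated_body_limits with m a j k t0 d; auto. }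
    intros []; [apply (W body1 body2 body3) | apply (W body2 body1 body3) | apply (W body3 body1 body2)];
      discriminate. }
  destruct (choose_body _ (fun i => proj1 (Hlim i))) as [c Hc].
  destruct (choose_body _ (fun i => proj2 (Hlim i))) as [u Hu].
  revert Hmax. apply not_maximal_of_limits with c u; auto.
  - eapply Rbar_lt_trans; [apply Ht0 | apply Ht0].
  - intros i j Hij. apply (limit_separated b d (q i) (q j)); auto.
    assert (Hb : t0 < b) by apply Ht0.
    generalize (at_left_interval b (b - t0) ltac:(lra)). apply filter_imp.
    intros t Ht. apply Hsep; auto; lra.
Qed.

(** * Energy bounds for the pair and its behaviour at a finite endpoint *)

Lemma energy_distinct m x w (i j k : body) : i <> j -> i <> k -> j <> k ->
  energy m x w = / 2 * (m i * dot (w i) (w i) + m j * dot (w j) (w j) + m k * dot (w k) (w k))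
    - (m i * m j / enorm (minus (x i) (x j)) + m i * m k / enorm (minus (x i) (x k))
       + m j * m k / enorm (minus (x j) (x k))).
Proof.
  intros Hij Hik Hjk. unfold energy.
  rewrite (sum_bodies_distinct body1 body2 body3) by discriminate.
  simpl pow. rewrite !Rmult_1_r, !enorm_sqr. unfold Rdiv.
  destruct i, j, k; try congruence;
  rewrite ?(enorm_minus_sym (x body2) (x body1)), ?(enorm_minus_sym (x body3) (x body1)),
      ?(enorm_minus_sym (x body3) (x body2)); ring.
Qed.

Lemma centered_distinct m x (i j k : body) c : i <> j -> i <> k -> j <> k ->
  sum_bodies (fun i => scal (m i) (x i)) = zero ->
  m i * coord c (x i) + m j * coord c (x j) + m k * coord c (x k) = 0.
Proof.
  intros Hij Hik Hjk H. apply (f_equal (coord c)) in H.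
  rewrite coord_sum_bodies, coord_zero, (sum_bodies_distinct i j k), !coord_scal in H; auto.
Qed.

Lemma cauchy_schwarz u w : dot u w * dot u w <= dot u u * dot w w.
Proof.
  rewrite !dot_coord.
  set (a1 := coord axis1 u); set (a2 := coord axis2 u); set (a3 := coord axis3 u).
  set (b1 := coord axis1 w); set (b2 := coord axis2 w); set (b3 := coord axis3 w).
  assert (0 <= (a1 * b2 - a2 * b1) ^ 2 + (a1 * b3 - a3 * b1) ^ 2 + (a2 * b3 - a3 * b2) ^ 2)
    by (repeat apply Rplus_le_le_0_compat; apply pow2_ge_0).
  lra.
Qed.

(** Since [H < 0], the kinetic energy is at most [T = mi * mj / r + (mi * mk + mj * mk) / D], so the
    squared relative velocity is at most [4 * (/ mi + / mj) * T]. Multiplying by [r * r] and using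
    [r <= R0] gives this expression. *)
Definition pair_bound (mi mj mk R0 D : R) : R :=
  4 * (/ mi + / mj) * (R0 * R0 * ((mi * mk + mj * mk) / D) + R0 * (mi * mj)).

(** The factor [r * r] absorbs the growth of the kinetic energy like [/ r] near a collision of the
    pair. The product controls both the derivative of the squared distance and the angular momentum
    of the pair. *)
Lemma pair_bound_correct m x w (i j k : body) H R0 D : (forall i, 0 < m i) ->
  i <> j -> i <> k -> j <> k -> energy m x w = H -> H < 0 -> 0 < D ->
  0 < enorm (minus (x i) (x j)) <= R0 ->
  D <= enorm (minus (x i) (x k)) -> D <= enorm (minus (x j) (x k)) ->
  dot (minus (x i) (x j)) (minus (x i) (x j)) * dot (minus (w i) (w j)) (minus (w i) (w j))
    <= pair_bound (m i) (m j) (m k) R0 D.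
Proof.
  intros hm Hij Hik Hjk HE HH HD [Hr0 Hr] Hi Hj.
  rewrite (energy_distinct m x w i j k) in HE by auto.
  assert (Mi := hm i). assert (Mj := hm j). assert (Mk := hm k).
  set (r := enorm (minus (x i) (x j))) in *.
  assert (W : dot (minus (w i) (w j)) (minus (w i) (w j)) <= 2 * dot (w i) (w i) + 2 * dot (w j) (w j)).
  { rewrite !dot_coord, !coord_minus.
    assert (0 <= (coord axis1 (w i) + coord axis1 (w j)) ^ 2 + (coord axis2 (w i) + coord axis2 (w j)) ^ 2
      + (coord axis3 (w i) + coord axis3 (w j)) ^ 2)
      by (repeat apply Rplus_le_le_0_compat; apply pow2_ge_0).
    lra. }
  assert (Ci : m i * m k / enorm (minus (x i) (x k)) <= m i * m k / D).
  { apply Rmult_le_compat_l; [nra|]. apply Rinv_le_contravar; auto. }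
  assert (Cj : m j * m k / enorm (minus (x j) (x k)) <= m j * m k / D).
  { apply Rmult_le_compat_l; [nra|]. apply Rinv_le_contravar; auto. }
  assert (Vi := dot_ge0 (w i)). assert (Vj := dot_ge0 (w j)). assert (Vk := dot_ge0 (w k)).
  set (T := m i * m j / r + (m i * m k + m j * m k) / D).
  assert (HT : m i * dot (w i) (w i) + m j * dot (w j) (w j) <= 2 * T).
  { unfold T. replace ((m i * m k + m j * m k) / D) with (m i * m k / D + m j * m k / D) by (field; lra).
    assert (0 <= m k * dot (w k) (w k)) by (apply Rmult_le_pos; lra). lra. }
  assert (Ai : 0 <= m i * dot (w i) (w i)) by (apply Rmult_le_pos; lra).
  assert (Aj : 0 <= m j * dot (w j) (w j)) by (apply Rmult_le_pos; lra).
  assert (Bi : dot (w i) (w i) <= 2 * T * / m i).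
  { apply Rmult_le_reg_l with (m i); auto. replace (m i * (2 * T * / m i)) with (2 * T) by (field; lra). lra. }
  assert (Bj : dot (w j) (w j) <= 2 * T * / m j).
  { apply Rmult_le_reg_l with (m j); auto. replace (m j * (2 * T * / m j)) with (2 * T) by (field; lra). lra. }
  rewrite <- enorm_sqr. fold r.
  apply Rle_trans with (r * r * (4 * (/ m i + / m j) * T)).
  { apply Rmult_le_compat_l; [nra | lra]. }
  replace (r * r * (4 * (/ m i + / m j) * T)) with (4 * (/ m i + / m j) * (r * r * T)) by ring.
  assert (Ii := Rinv_0_lt_compat _ Mi). assert (Ij := Rinv_0_lt_compat _ Mj).
  unfold pair_bound. apply Rmult_le_compat_l; [lra|].
  replace (r * r * T) with (r * r * ((m i * m k + m j * m k) / D) + r * (m i * m j))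
    by (unfold T; field; lra).
  apply Rplus_le_compat; apply Rmult_le_compat_r; try nra.
  apply Rdiv_le_0_compat; nra.
Qed.

Lemma filterlim_zero_of_square {T} (F : (T -> Prop) -> Prop) {FF : Filter F} (f : T -> vec3) c :
  filterlim (fun x => dot (f x) (f x)) F (locally 0) ->
  filterlim (fun x => coord c (f x)) F (locally 0).
Proof.
  intros H. apply filterlim_locally_R; [exact FF|]. intros eps.
  assert (He : 0 < eps * eps) by (destruct eps; simpl; nra).
  generalize (proj1 (filterlim_locally_R _ _ _) H (mkposreal _ He)). apply filter_imp.
  intros x Hx. cbn [pos] in Hx. rewrite Rminus_0_r in Hx |- *.
  rewrite Rabs_pos_eq, <- enorm_sqr in Hx by apply dot_ge0.
  eapply Rle_lt_trans; [apply coord_le_enorm|].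
  assert (H0 := enorm_ge0 (f x)). destruct eps as [e Hep]; simpl in *. nra.
Qed.

(** The limit [l] of the squared distance of the pair decides. If [l > 0], all distances are bounded
    below near [b] and the orbit extends; if [l = 0], the pair collides away from the third body. *)
Lemma hierarchical_forward_complete m a (b : R) q v (i j k : body) H R0 D :
  (forall i, 0 < m i) -> i <> j -> i <> k -> j <> k -> H < 0 -> 0 < D ->
  in_interval a b 0 -> maximal_solution m a b q v -> ~ has_binary_collision a b q ->
  (forall t, in_interval a b t ->
    centered m (fun i => q i t) /\
    energy m (fun i => q i t) (fun i => v i t) = H /\
    enorm (minus (q i t) (q j t)) <= R0 /\
    D <= enorm (minus (q i t) (q k t)) /\ D <= enorm (minus (q j t) (q k t))) -> False.
Proof.
  intros hm Hij Hik Hjk HH HD H0 Hmax Hnb Hall. assert (Hs := proj1 Hmax).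
  assert (Hb : 0 < b) by apply H0.
  assert (Hin : forall t, 0 <= t < b -> in_interval a b t)
    by (intros t; now apply in_interval_right).
  set (d := fun t => minus (q i t) (q j t)).
  assert (Hd0 : forall t, 0 <= t < b -> 0 < enorm (d t)).
  { intros t Ht. apply enorm_pos. now apply (Hs t (Hin t Ht)). }
  destruct (separated_body_limits m a b q v k i j 0 D) as [[ck Hck] _]; auto.
  { intros t Ht. destruct (Hall t (Hin t Ht)) as (_ & _ & _ & H1 & H2).
    now rewrite !(enorm_minus_sym (q k t)). }
  destruct (bounded_derivative_limit (fun t => dot (d t) (d t))
    (fun t => 2 * dot (d t) (minus (v i t) (v j t))) 0 b
    (1 + pair_bound (m i) (m j) (m k) R0 D) Hb) as [l Hl].
  { intros t Ht. destruct (solution_newton_at m a b q v t hm Hs) as (_ & Hq & _); [apply Hin; lra|].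
    assert (Dd : is_derive d t (minus (v i t) (v j t)))
      by exact (is_derive_minus (q i) (q j) t _ _ (Hq i) (Hq j)).
    generalize (is_derive_dot _ _ _ _ _ Dd Dd). apply is_derive_eq.
    rewrite !dot_coord. ring. }
  { intros t Ht. assert (Ht' : 0 <= t < b) by lra.
    destruct (Hall t (Hin t Ht')) as (_ & HE & H1 & H2 & H3).
    assert (P := pair_bound_correct m (fun i => q i t) (fun i => v i t) i j k H R0 D
      hm Hij Hik Hjk HE HH HD (conj (Hd0 t Ht') H1) H2 H3).
    assert (C := cauchy_schwarz (d t) (minus (v i t) (v j t))). cbv beta in P. fold (d t) in P.
    (* The derivative is [2 * z]. Cauchy-Schwarz bounds [z * z] by [pair_bound], and the squares of
       [z - 1] and [z + 1] give [|2 * z| <= 1 + z * z]. *)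
    set (z := dot (d t) (minus (v i t) (v j t))) in *.
    assert (0 <= (z - 1) * (z - 1)) by apply Rle_0_sqr.
    assert (0 <= (z + 1) * (z + 1)) by apply Rle_0_sqr.
    apply Rabs_le; lra. }
  assert (Hl0 : 0 <= l).
  { destruct (Rle_dec 0 l) as [|N]; auto. exfalso.
    assert (Hneg : 0 < - l) by lra.
    destruct (filter_ex (F := at_left b) _ (proj1 (filterlim_locally_R _ _ _) Hl (mkposreal _ Hneg))) as [t Ht].
    cbn [pos] in Ht. apply Rabs_lt_between in Ht. assert (P := dot_ge0 (d t)). lra. }
  destruct (Rle_lt_or_eq_dec 0 l Hl0) as [Hlp|<-].
  - assert (Hhalf : 0 < l / 2) by lra.
    assert (Hev := filter_and _ _ (at_left_interval b b Hb)
      (proj1 (filterlim_locally_R _ _ _) Hl (mkposreal _ Hhalf))).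
    destruct Hev as [e He].
    (* From [t0] on, the squared distance is within [l / 2] of [l]. Halving [e] puts [t0] itself
       inside the open ball. *)
    set (t0 := Rmax 0 (b - e / 2)).
    assert (Ht0 : 0 <= t0 < b).
    { unfold t0. split; [apply Rmax_l|]. apply Rmax_lub_lt; auto. destruct e; simpl; lra. }
    set (dd := Rmin D (sqrt (l / 2))).
    apply (separated_not_maximal m a b q v t0 dd hm); auto.
    + apply Rmin_pos; auto. now apply sqrt_lt_R0.
    + intros t i' j' Ht Hij'. assert (Ht' : 0 <= t < b) by lra.
      destruct (Hall t (Hin t Ht')) as (_ & _ & _ & H2 & H3).
      assert (H1 : sqrt (l / 2) <= enorm (minus (q i t) (q j t))).
      { assert (Bt : ball b e t).
        { change (Rabs (t - b) < e). assert (b - e / 2 <= t0) by apply Rmax_r.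
          apply Rabs_def1; destruct e; simpl in *; lra. }
        destruct (He t Bt (proj2 Ht)) as [_ Hc]. cbn [pos] in Hc. apply Rabs_lt_between in Hc.
        apply sqrt_le_1_alt. fold (d t). lra. }
      assert (M1 : dd <= D) by apply Rmin_l. assert (M2 : dd <= sqrt (l / 2)) by apply Rmin_r.
      assert (S1 := enorm_minus_sym (q i t) (q j t)). assert (S2 := enorm_minus_sym (q i t) (q k t)).
      assert (S3 := enorm_minus_sym (q j t) (q k t)).
      destruct i, j, k; try congruence; destruct i', j'; try congruence; lra.
  - apply Hnb. right. exists b. split; [reflexivity|].
    assert (Mi := hm i). assert (Mj := hm j).
    (* With the centre of mass at the origin, a pair contracted to a point sits at
       [- m k / (m i + m j)] times the position of [k]. *)
    exists (fun l => if body_eq_dec l k then ck else scal (- (m k / (m i + m j))) ck).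
    assert (Hlim : forall c, filterlim (fun t => coord c (d t)) (at_left b) (locally 0))
      by (intros c; apply filterlim_zero_of_square; [typeclasses eauto | exact Hl]).
    assert (Hckc := proj1 (filterlim_coord (at_left b) (q k) ck) Hck).
    assert (Hnear : at_left b (fun t => in_interval a b t)).
    { generalize (at_left_interval b b Hb). apply filter_imp. intros t Ht. apply Hin; lra. }
    (* The positions of [i] and [j] are written in Jacobi coordinates: a fixed multiple of [q k]
       plus [s] times the separation [d], which tends to zero. *)
    assert (Hpair : forall (l : body) (s : R),
      (forall t c, in_interval a b t ->
        coord c (q l t) = - (m k / (m i + m j)) * coord c (q k t) + s * coord c (d t)) ->
      filterlim (q l) (at_left b) (locally (scal (- (m k / (m i + m j))) ck))).
    { intros l s E. apply (filterlim_coord (at_left b) (q l)). intros c. rewrite coord_scal.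
      apply filterlim_ext_loc with (fun t => - (m k / (m i + m j)) * coord c (q k t) + s * coord c (d t)).
      { revert Hnear. apply filter_imp. intros t Ht. symmetry. now apply E. }
      replace (- (m k / (m i + m j)) * coord c ck) with (- (m k / (m i + m j)) * coord c ck + s * 0) by ring.
      apply filterlim_Rplus; [typeclasses eauto | |];
        (apply filterlim_Rscal; [typeclasses eauto|]); auto. }
    assert (Qi : filterlim (q i) (at_left b) (locally (scal (- (m k / (m i + m j))) ck))).
    { apply (Hpair i (m j / (m i + m j))). intros t c Ht. unfold d. rewrite coord_minus.
      destruct (Hall t Ht) as (Hc & _).
      assert (E := centered_distinct m (fun i => q i t) i j k c Hij Hik Hjk Hc). cbv beta in E.
      apply Rmult_eq_reg_l with (m i + m j); [|lra]. field_simplify; lra. }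
    assert (Qj : filterlim (q j) (at_left b) (locally (scal (- (m k / (m i + m j))) ck))).
    { apply (Hpair j (- (m i / (m i + m j)))). intros t c Ht. unfold d. rewrite coord_minus.
      destruct (Hall t Ht) as (Hc & _).
      assert (E := centered_distinct m (fun i => q i t) i j k c Hij Hik Hjk Hc). cbv beta in E.
      apply Rmult_eq_reg_l with (m i + m j); [|lra]. field_simplify; lra. }
    split.
    + intros l. destruct (body_eq_dec l k) as [->|Hlk]; [exact Hck|].
      destruct (body_eq_dec l i) as [->|Hli]; [exact Qi|].
      destruct (body_eq_dec l j) as [->|Hlj]; [exact Qj|].
      exfalso. destruct i, j, k, l; congruence.
    + exists i, j, k. split; [exact Hij|].
      destruct (body_eq_dec i k) as [|_]; [contradiction|].
      destruct (body_eq_dec j k) as [|_]; [contradiction|].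
      destruct (body_eq_dec k k) as [_|N]; [|congruence]. split; [reflexivity|].
      (* The distance [D] persists in the limit, so the collision is binary and not triple. *)
      apply (limit_separated b D (q k) (q i)); auto.
      revert Hnear. apply filter_imp. intros t Ht. rewrite enorm_minus_sym. now apply Hall.
Qed.

(** * Time reversal *)

Lemma in_interval_opp a b t : in_interval (Rbar_opp b) (Rbar_opp a) t -> in_interval a b (- t).
Proof.
  intros [H1 H2]. split.
  - destruct a; simpl in *; auto; lra.
  - destruct b; simpl in *; auto; lra.
Qed.

Lemma is_derive_reverse (f : R -> vec3) t l :
  is_derive f (- t) l -> is_derive (fun s => f (- s)) t (opp l).
Proof.
  intros H. replace (opp l) with (scal (-1) l)
    by (apply vec3_ext; intros c; rewrite coord_scal, coord_opp; ring).
  apply (is_derive_comp f Ropp t l (-1)); [exact H|]. auto_derive; [auto | ring].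
Qed.

Definition reverse_position (q : body -> R -> vec3) : body -> R -> vec3 := fun i t => q i (- t).
Definition reverse_velocity (v : body -> R -> vec3) : body -> R -> vec3 := fun i t => opp (v i (- t)).

(** Reversal changes the sign of the velocities and leaves accelerations unchanged, since the two
    signs cancel. *)
Lemma reverse_solution m a b q v : solution m a b q v ->
  solution m (Rbar_opp b) (Rbar_opp a) (reverse_position q) (reverse_velocity v).
Proof.
  intros H t Ht. destruct (H (- t) (in_interval_opp _ _ _ Ht)) as (Hn & Hq & Hv).
  split; [exact Hn | split].
  - intros i. now apply is_derive_reverse.
  - intros i. destruct (Hv i) as (acc & Ha & E). exists acc. split; [|exact E].
    rewrite <- (opp_opp acc).
    apply (is_derive_opp (fun s => v i (- s))). now apply is_derive_reverse.
Qed.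

Lemma reverse_maximal m a b q v : maximal_solution m a b q v ->
  maximal_solution m (Rbar_opp b) (Rbar_opp a) (reverse_position q) (reverse_velocity v).
Proof.
  intros [Hs Hm]. split; [now apply reverse_solution|].
  intros a' b' q' v' Ha Hb Hs' E.
  destruct (Hm (Rbar_opp b') (Rbar_opp a') (reverse_position q') (reverse_velocity v')) as [E1 E2].
  - rewrite <- (Rbar_opp_involutive a). now apply Rbar_opp_le.
  - rewrite <- (Rbar_opp_involutive b). now apply Rbar_opp_le.
  - now apply reverse_solution.
  - intros i t Ht. unfold reverse_position. rewrite E.
    + unfold reverse_position. now rewrite Ropp_involutive.
    + apply in_interval_opp. now rewrite !Rbar_opp_involutive.
  - rewrite <- E1, <- E2, !Rbar_opp_involutive. auto.
Qed.

Lemma filterlim_opp_at_left T : filterlim Ropp (at_left (- T)) (at_right T).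
Proof.
  intros P [e He]. exists e. intros s Hs Hlt. apply He; [|lra].
  change (Rabs (s - - T) < e) in Hs. change (Rabs (- s - T) < e).
  rewrite <- Rabs_Ropp. replace (- (- s - T)) with (s - - T) by ring. exact Hs.
Qed.

Lemma filterlim_opp_at_right T : filterlim Ropp (at_right (- T)) (at_left T).
Proof.
  intros P [e He]. exists e. intros s Hs Hlt. apply He; [|lra].
  change (Rabs (s - - T) < e) in Hs. change (Rabs (- s - T) < e).
  rewrite <- Rabs_Ropp. replace (- (- s - T)) with (s - - T) by ring. exact Hs.
Qed.

Lemma reverse_binary_collision F G {FG : Filter G} q : filterlim Ropp G F ->
  binary_collision_along F (reverse_position q) -> binary_collision_along G q.
Proof.
  intros HFG (c & Hc & E). exists c. split; [|exact E]. intros i.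
  apply filterlim_ext with (fun t => reverse_position q i (- t)).
  - intros t. unfold reverse_position. now rewrite Ropp_involutive.
  - apply filterlim_comp with (1 := HFG), Hc.
Qed.

Lemma reverse_has_binary_collision a b q :
  has_binary_collision (Rbar_opp b) (Rbar_opp a) (reverse_position q) -> has_binary_collision a b q.
Proof.
  intros [(T & E & H)|(T & E & H)]; [right | left]; exists (- T); split.
  - rewrite <- (Rbar_opp_involutive b), E. reflexivity.
  - revert H. apply reverse_binary_collision; [typeclasses eauto | apply filterlim_opp_at_left].
  - rewrite <- (Rbar_opp_involutive a), E. reflexivity.
  - revert H. apply reverse_binary_collision; [typeclasses eauto | apply filterlim_opp_at_right].
Qed.

Lemma energy_opp m x w : energy m x (fun i => opp (w i)) = energy m x w.
Proof.
  rewrite !(energy_distinct m x _ body1 body2 body3) by discriminate.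
  rewrite !dot_coord, !coord_opp. f_equal. f_equal. ring.
Qed.

Lemma hierarchical_backward_complete m (a : R) b q v (i j k : body) H R0 D :
  (forall i, 0 < m i) -> i <> j -> i <> k -> j <> k -> H < 0 -> 0 < D ->
  in_interval a b 0 -> maximal_solution m a b q v -> ~ has_binary_collision a b q ->
  (forall t, in_interval a b t ->
    centered m (fun i => q i t) /\
    energy m (fun i => q i t) (fun i => v i t) = H /\
    enorm (minus (q i t) (q j t)) <= R0 /\
    D <= enorm (minus (q i t) (q k t)) /\ D <= enorm (minus (q j t) (q k t))) -> False.
Proof.
  intros hm Hij Hik Hjk HH HD H0 Hmax Hnb Hall.
  apply (hierarchical_forward_complete m (Rbar_opp b) (- a) (reverse_position q) (reverse_velocity v)
    i j k H R0 D); auto.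
  - destruct H0 as [H1 H2]. split; [destruct b; simpl in *; auto; lra | simpl in *; lra].
  - now apply (reverse_maximal m a b q v).
  - intros Hc. apply Hnb. now apply reverse_has_binary_collision.
  - intros t Ht. destruct (Hall (- t)) as (A1 & A2 & A3); [now apply in_interval_opp|].
    split; [exact A1 | split; [|exact A3]].
    rewrite <- A2. apply (energy_opp m (fun i => q i (- t)) (fun i => v i (- t))).
Qed.

(** * Hierarchical configurations *)

Lemma enorm_triangle (u w z : vec3) : enorm (minus u z) <= enorm (minus u w) + enorm (minus w z).
Proof.
  assert (C := cauchy_schwarz (minus u w) (minus w z)).
  assert (E : dot (minus u z) (minus u z) = dot (minus u w) (minus u w)
    + dot (minus w z) (minus w z) + 2 * dot (minus u w) (minus w z))
    by (rewrite !dot_coord, !coord_minus; ring).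
  rewrite <- (enorm_sqr (minus u w)), <- (enorm_sqr (minus w z)) in C, E.
  rewrite <- (enorm_sqr (minus u z)) in E.
  assert (P1 := enorm_ge0 (minus u w)). assert (P2 := enorm_ge0 (minus w z)).
  assert (P3 := enorm_ge0 (minus u z)).
  set (x := enorm (minus u w)) in *. set (y := enorm (minus w z)) in *. set (n := enorm (minus u z)) in *.
  set (p := dot (minus u w) (minus w z)) in *.
  assert (Hp : p <= x * y).
  { apply Rnot_lt_le; intros N. assert (0 <= x * y) by now apply Rmult_le_pos. nra. }
  apply Rnot_lt_le; intros N.
  assert ((x + y) * (x + y) < n * n) by (apply Rmult_le_0_lt_compat; lra). lra.
Qed.

(** If all three distances exceeded [R0], the sum of the [m_i m_j / r_ij] would be less than [-H],
    and the kinetic energy, being nonnegative, could not bring the energy down to [H]. *)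
Lemma tight_pair m x w H R0 : (forall i, 0 < m i) -> (forall i j, i <> j -> x i <> x j) ->
  energy m x w = H -> H < 0 ->
  R0 = (m body1 * m body2 + m body1 * m body3 + m body2 * m body3) / - H ->
  exists i j k, i <> j /\ i <> k /\ j <> k /\ enorm (minus (x i) (x j)) <= R0.
Proof.
  intros hm Hn HE HH ->.
  set (A := m body1 * m body2 + m body1 * m body3 + m body2 * m body3).
  assert (M1 := hm body1). assert (M2 := hm body2). assert (M3 := hm body3).
  assert (P12 : 0 < m body1 * m body2) by nra. assert (P13 : 0 < m body1 * m body3) by nra.
  assert (P23 : 0 < m body2 * m body3) by nra.
  assert (HA : 0 < A) by (unfold A; lra).
  destruct (Rle_dec (enorm (minus (x body1) (x body2))) (A / - H)) as [?|N12];
    [exists body1, body2, body3; repeat split; auto; discriminate|].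
  destruct (Rle_dec (enorm (minus (x body1) (x body3))) (A / - H)) as [?|N13];
    [exists body1, body3, body2; repeat split; auto; discriminate|].
  destruct (Rle_dec (enorm (minus (x body2) (x body3))) (A / - H)) as [?|N23];
    [exists body2, body3, body1; repeat split; auto; discriminate|].
  exfalso. apply Rnot_le_lt in N12, N13, N23.
  assert (HR : 0 < A / - H) by (apply Rdiv_lt_0_compat; lra).
  assert (W : forall r p, A / - H < r -> 0 < p -> p / r < p * (- H / A)).
  { intros r p Hr Hp. apply Rmult_lt_compat_l; auto.
    replace (- H / A) with (/ (A / - H)) by (field; lra). apply Rinv_lt_contravar; auto. apply Rmult_lt_0_compat; lra. }
  rewrite (energy_distinct m x w body1 body2 body3) in HE by discriminate.
  assert (W12 := W _ _ N12 P12). assert (W13 := W _ _ N13 P13). assert (W23 := W _ _ N23 P23).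
  assert (E : m body1 * m body2 * (- H / A) + m body1 * m body3 * (- H / A) + m body2 * m body3 * (- H / A) = - H)
    by (unfold A in *; field; lra).
  assert (K1 := Rmult_le_pos _ _ (Rlt_le _ _ M1) (dot_ge0 (w body1))).
  assert (K2 := Rmult_le_pos _ _ (Rlt_le _ _ M2) (dot_ge0 (w body2))).
  assert (K3 := Rmult_le_pos _ _ (Rlt_le _ _ M3) (dot_ge0 (w body3))).
  lra.
Qed.

Lemma inertia_lagrange m x : centered m x ->
  (m body1 + m body2 + m body3) * moment_of_inertia m x =
  m body1 * m body2 * enorm (minus (x body1) (x body2)) ^ 2
  + m body1 * m body3 * enorm (minus (x body1) (x body3)) ^ 2
  + m body2 * m body3 * enorm (minus (x body2) (x body3)) ^ 2.
Proof.
  intros Hc. unfold moment_of_inertia.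
  rewrite (sum_bodies_distinct body1 body2 body3) by discriminate.
  simpl pow. rewrite !Rmult_1_r, !enorm_sqr, !dot_coord, !coord_minus.
  assert (E : forall c, m body1 * coord c (x body1) + m body2 * coord c (x body2) + m body3 * coord c (x body3) = 0)
    by (intros c; apply centered_distinct; auto; discriminate).
  assert (E1 := E axis1). assert (E2 := E axis2). assert (E3 := E axis3).
  (* Without centering, the two sides differ exactly by the squared norm of the sum of the
     [m_i x_i]. *)
  match goal with |- ?l = ?r => cut (l - r = 
    (m body1 * coord axis1 (x body1) + m body2 * coord axis1 (x body2) + m body3 * coord axis1 (x body3)) ^ 2
    + (m body1 * coord axis2 (x body1) + m body2 * coord axis2 (x body2) + m body3 * coord axis2 (x body3)) ^ 2
    + (m body1 * coord axis3 (x body1) + m body2 * coord axis3 (x body2) + m body3 * coord axis3 (x body3)) ^ 2);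
    [rewrite E1, E2, E3; lra | ring] end.
Qed.

(** The moment of inertia of a centered configuration whose three mutual distances all equal
    [D + R0]. *)
Definition inertia_threshold (m : body -> R) (R0 D : R) : R :=
  (m body1 * m body2 + m body1 * m body3 + m body2 * m body3) * (D + R0) ^ 2
    / (m body1 + m body2 + m body3).

(** If the third body were closer than [D] to one member of the tight pair, the triangle inequality
    would bound all distances by [D + R0], and the moment of inertia by the threshold. *)
Lemma hierarchical_configuration m x w H R0 D : (forall i, 0 < m i) ->
  (forall i j, i <> j -> x i <> x j) -> centered m x ->
  energy m x w = H -> H < 0 ->
  R0 = (m body1 * m body2 + m body1 * m body3 + m body2 * m body3) / - H ->
  0 < D -> inertia_threshold m R0 D < moment_of_inertia m x ->
  exists i j k, i <> j /\ i <> k /\ j <> k /\ enorm (minus (x i) (x j)) <= R0 /\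
    D <= enorm (minus (x i) (x k)) /\ D <= enorm (minus (x j) (x k)).
Proof.
  intros hm Hn Hc HE HH HR HD HI.
  destruct (tight_pair m x w H R0 hm Hn HE HH HR) as (i & j & k & Hij & Hik & Hjk & Hr).
  exists i, j, k. repeat (split; [assumption|]).
  assert (T1 := enorm_triangle (x i) (x j) (x k)). assert (T2 := enorm_triangle (x j) (x i) (x k)).
  rewrite (enorm_minus_sym (x j) (x i)) in T2.
  destruct (Rle_dec D (enorm (minus (x i) (x k)))) as [L1|N1];
  destruct (Rle_dec D (enorm (minus (x j) (x k)))) as [L2|N2]; [auto | | |]; exfalso.
  all: assert (S12 := enorm_minus_sym (x body1) (x body2));
    assert (S13 := enorm_minus_sym (x body1) (x body3));
    assert (S23 := enorm_minus_sym (x body2) (x body3)).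
  all: assert (B12 : enorm (minus (x body1) (x body2)) <= D + R0)
    by (destruct i, j, k; try congruence; lra).
  all: assert (B13 : enorm (minus (x body1) (x body3)) <= D + R0)
    by (destruct i, j, k; try congruence; lra).
  all: assert (B23 : enorm (minus (x body2) (x body3)) <= D + R0)
    by (destruct i, j, k; try congruence; lra).
  all: assert (M1 := hm body1); assert (M2 := hm body2); assert (M3 := hm body3).
  all: assert (L := inertia_lagrange m x Hc).
  all: assert (W : forall p u, 0 < p -> enorm u <= D + R0 -> p * enorm u ^ 2 <= p * (D + R0) ^ 2)
    by (intros p u Hp Hu; apply Rmult_le_compat_l; [lra|]; apply pow_incr; split; [apply enorm_ge0 | exact Hu]).
  all: assert (W12 := W _ _ (Rmult_lt_0_compat _ _ M1 M2) B12);
    assert (W13 := W _ _ (Rmult_lt_0_compat _ _ M1 M3) B13);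
    assert (W23 := W _ _ (Rmult_lt_0_compat _ _ M2 M3) B23).
  all: apply (Rmult_lt_compat_l (m body1 + m body2 + m body3)) in HI; [|lra].
  all: unfold inertia_threshold in HI;
    replace ((m body1 + m body2 + m body3) * ((m body1 * m body2 + m body1 * m body3 + m body2 * m body3) * (D + R0) ^ 2
    / (m body1 + m body2 + m body3))) with
    ((m body1 * m body2 + m body1 * m body3 + m body2 * m body3) * (D + R0) ^ 2) in HI by (field; lra);
    lra.
Qed.

(** * Two facts about functions of one real variable *)

(** The graph lies below each of its tangents, and a tangent of nonzero slope reaches zero. *)
Lemma positive_not_strictly_concave (f g h : R -> R) :
  (forall t, is_derive f t (g t)) -> (forall t, is_derive g t (h t)) ->
  (forall t, 0 < f t) -> (forall t, h t < 0) -> False.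
Proof.
  intros Hf Hg Hp Hh.
  assert (MV : forall (F G : R -> R), (forall t, is_derive F t (G t)) -> forall x y, x < y ->
    exists c, x <= c <= y /\ F y - F x = G c * (y - x)).
  { intros F G HF x y Hxy. destruct (MVT_gen F x y G) as (c & Hc & E).
    - intros t _. apply HF.
    - intros t _. apply continuity_pt_filterlim, @ex_derive_continuous. now exists (G t).
    - rewrite Rmin_left, Rmax_right in Hc by lra. now exists c. }
  assert (Hdec : forall x y, x < y -> g y < g x).
  { intros x y Hxy. destruct (MV g h Hg x y Hxy) as (c & _ & E). specialize (Hh c). nra. }
  assert (H01 := Hdec 0 1 ltac:(lra)).
  (* Since [g] decreases strictly, either [g 1 < 0] or [g 0 > 0]. In each case [y] is the zero of
     the tangent at that point. *)
  destruct (Rlt_le_dec (g 1) 0) as [Hn|Hn].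
  - set (y := 1 + f 1 / - g 1).
    assert (P1 := Hp 1). assert (Hq : 0 < f 1 / - g 1) by (apply Rdiv_lt_0_compat; lra).
    destruct (MV f g Hf 1 y) as (c & Hc & E); [unfold y; lra|].
    assert (Hgc : g c <= g 1) by (destruct (proj1 Hc) as [L|<-]; [left; auto | lra]).
    assert (P2 := Hp y).
    assert (E2 : - g 1 * (y - 1) = f 1) by (unfold y; field; lra).
    assert (0 < y - 1) by (unfold y; lra). nra.
  - assert (P0 : 0 < g 0) by lra.
    set (y := 0 - f 0 / g 0).
    assert (P1 := Hp 0). assert (Hq : 0 < f 0 / g 0) by (apply Rdiv_lt_0_compat; lra).
    destruct (MV f g Hf y 0) as (c & Hc & E); [unfold y; lra|].
    assert (Hgc : g 0 <= g c) by (destruct (proj2 Hc) as [L| ->]; [left; auto | lra]).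
    assert (P2 := Hp y).
    assert (E2 : g 0 * (0 - y) = f 0) by (unfold y; field; lra).
    assert (0 < 0 - y) by (unfold y; lra). nra.
Qed.

(** To pass from below [r] to above [d], [f] would take the midpoint value, which lies in the
    forbidden gap. *)
Lemma continuous_confined (a b : Rbar) (f : R -> R) (r d : R) : r < d ->
  (forall t, in_interval a b t -> continuous f t /\ (f t <= r \/ d <= f t)) ->
  in_interval a b 0 -> f 0 <= r -> forall t, in_interval a b t -> f t <= r.
Proof.
  intros Hrd Hf H0 Hf0 t Ht. apply Rnot_lt_le; intros Hlt.
  destruct (Hf t Ht) as [_ [?|Hd]]; [lra|].
  set (c := (r + d) / 2).
  assert (Hin : forall x, Rmin 0 t <= x <= Rmax 0 t -> in_interval a b x).
  { intros x Hx. destruct (Rle_dec 0 t).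
    - rewrite Rmin_left, Rmax_right in Hx by lra. now apply in_interval_between with 0 t.
    - rewrite Rmin_right, Rmax_left in Hx by lra. now apply in_interval_between with t 0. }
  assert (Hz : exists z, Rmin 0 t <= z <= Rmax 0 t /\ f z = c).
  { destruct (total_order_T 0 t) as [[H|H]|H].
    - destruct (Ranalysis5.IVT_interv (fun x => f x - c) 0 t) as (z & Hz & E); try (unfold c; lra).
      + intros x Hx. apply continuity_pt_filterlim.
        apply (continuous_minus f (fun _ => c)); [|apply continuous_const].
        apply Hf, Hin. rewrite Rmin_left, Rmax_right by lra. exact Hx.
      + exists z. rewrite Rmin_left, Rmax_right by lra. split; [exact Hz | lra].
    - subst t. lra.
    - destruct (Ranalysis5.IVT_interv (fun x => c - f x) t 0) as (z & Hz & E); try (unfold c; lra).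
      + intros x Hx. apply continuity_pt_filterlim.
        apply (continuous_minus (fun _ => c) f); [apply continuous_const|].
        apply Hf, Hin. rewrite Rmin_right, Rmax_left by lra. exact Hx.
      + exists z. rewrite Rmin_right, Rmax_left by lra. split; [exact Hz | lra]. }
  destruct Hz as (z & Hz & E). destruct (Hf z (Hin z Hz)) as [_ Hc]. unfold c in E. lra.
Qed.

(** * Concavity of the outer distance *)

(** Centering gives [M * x k = - (m i * u + m j * w)], where [u] and [w] point from [k] to [i] and
    [j]. As [u] and [w] form no obtuse angle, all cross terms have a favourable sign, and body [i]
    alone gives a lower bound that grows linearly in [D]. *)
Lemma outer_attraction m x (i j k : body) D : (forall i, 0 < m i) ->
  i <> j -> i <> k -> j <> k -> centered m x -> 0 < D ->
  enorm (minus (x i) (x j)) <= D ->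
  D <= enorm (minus (x i) (x k)) -> D <= enorm (minus (x j) (x k)) ->
  0 < dot (x k) (x k) /\
  m i ^ 4 * D <= - ((m i + m j + m k) ^ 3 * dot (x k) (acceleration m x k) * dot (x k) (x k)).
Proof.
  intros hm Hij Hik Hjk Hc HD Hr Hi Hj.
  assert (Mi := hm i). assert (Mj := hm j). assert (Mk := hm k).
  set (M := m i + m j + m k). assert (HM : 0 < M) by (unfold M; lra).
  assert (Ec : forall c, M * coord c (x k) =
    - (m i * coord c (minus (x i) (x k)) + m j * coord c (minus (x j) (x k)))).
  { intros c. assert (E := centered_distinct m x i j k c Hij Hik Hjk Hc).
    rewrite !coord_minus. unfold M. lra. }
  set (u := minus (x i) (x k)) in *. set (w := minus (x j) (x k)) in *.
  set (z := minus (x i) (x j)) in *.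
  assert (Hz : forall c, coord c w = coord c u - coord c z)
    by (intros c; unfold u, w, z; rewrite !coord_minus; ring).
  (* The pair is no wider than its distance from [k]: [u . w = |u|^2 - u . z] and
     [|z| <= D <= |u|]. *)
  assert (HP : 0 <= dot u w).
  { replace (dot u w) with (dot u u - dot u z) by (rewrite !dot_coord, !Hz; ring).
    assert (C := cauchy_schwarz u z). rewrite <- (enorm_sqr u), <- (enorm_sqr z) in C.
    rewrite <- (enorm_sqr u).
    assert (Z := enorm_ge0 z). set (s := dot u z) in *.
    apply Rnot_lt_le; intros N.
    assert (enorm z * enorm z <= enorm u * enorm u) by (apply Rmult_le_compat; lra).
    assert (0 < enorm u * enorm u) by nra.
    assert (enorm u * enorm u * (enorm u * enorm u) < s * s) by (apply Rmult_le_0_lt_compat; lra).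
    assert (enorm u * enorm u * (enorm z * enorm z) <= enorm u * enorm u * (enorm u * enorm u))
      by (apply Rmult_le_compat_l; lra).
    lra. }
  assert (S : M * M * dot (x k) (x k) =
    m i * m i * (enorm u * enorm u) + 2 * (m i * m j * dot u w) + m j * m j * (enorm w * enorm w)).
  { rewrite !enorm_sqr, !(dot_coord (x k)).
    replace (M * M * (coord axis1 (x k) * coord axis1 (x k) + coord axis2 (x k) * coord axis2 (x k)
      + coord axis3 (x k) * coord axis3 (x k)))
      with (M * coord axis1 (x k) * (M * coord axis1 (x k)) + M * coord axis2 (x k) * (M * coord axis2 (x k))
      + M * coord axis3 (x k) * (M * coord axis3 (x k))) by ring.
    rewrite !Ec, !dot_coord. ring. }
  assert (A : - (M * dot (x k) (acceleration m x k)) =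
    m i / enorm u ^ 3 * (m i * (enorm u * enorm u) + m j * dot u w)
    + m j / enorm w ^ 3 * (m i * dot u w + m j * (enorm w * enorm w))).
  { rewrite !enorm_sqr.
    assert (Ha : forall c, coord c (acceleration m x k) =
      m i / enorm u ^ 3 * coord c u + m j / enorm w ^ 3 * coord c w).
    { intros c. rewrite coord_acceleration, (coord_force_distinct m x k i j c) by auto.
      rewrite !(enorm_minus_sym (x k)). fold u w.
      replace (coord c u) with (coord c (x i) - coord c (x k)) by (unfold u; now rewrite coord_minus).
      replace (coord c w) with (coord c (x j) - coord c (x k)) by (unfold w; now rewrite coord_minus).
      field. repeat split; lra. }
    rewrite (dot_coord (x k)).
    replace (M * (coord axis1 (x k) * coord axis1 (acceleration m x k) + coord axis2 (x k) * coord axis2 (acceleration m x k)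
      + coord axis3 (x k) * coord axis3 (acceleration m x k)))
      with (M * coord axis1 (x k) * coord axis1 (acceleration m x k) + M * coord axis2 (x k) * coord axis2 (acceleration m x k)
      + M * coord axis3 (x k) * coord axis3 (acceleration m x k)) by ring.
    rewrite !Ec, !Ha, !dot_coord. ring. }
  assert (P2 : 0 <= m i * m j * dot u w) by (apply Rmult_le_pos; nra).
  assert (Gu : 0 < enorm u) by lra. assert (Gw : 0 < enorm w) by lra.
  assert (S1 : m i * m i * (enorm u * enorm u) <= M * M * dot (x k) (x k)).
  { assert (0 <= m j * m j * (enorm w * enorm w)) by (apply Rmult_le_pos; nra). lra. }
  assert (A1 : m i * m i / enorm u <= - (M * dot (x k) (acceleration m x k))).
  { rewrite A.
    assert (0 <= m j / enorm w ^ 3 * (m i * dot u w + m j * (enorm w * enorm w))).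
    { apply Rmult_le_pos; [apply Rdiv_le_0_compat; [lra | now apply pow_lt]|].
      apply Rplus_le_le_0_compat; apply Rmult_le_pos; nra. }
    assert (0 <= m i / enorm u ^ 3 * (m j * dot u w)).
    { apply Rmult_le_pos; [apply Rdiv_le_0_compat; [lra | now apply pow_lt]|].
      apply Rmult_le_pos; lra. }
    replace (m i * m i / enorm u) with (m i / enorm u ^ 3 * (m i * (enorm u * enorm u))) by (field; lra).
    lra. }
  split.
  - apply Rmult_lt_reg_l with (M * M); [nra|]. rewrite Rmult_0_r.
    eapply Rlt_le_trans; [|exact S1]. repeat apply Rmult_lt_0_compat; auto.
  (* Multiplying [A1] by [S1] leaves one factor [|u|], which is at least [D]. *)
  - apply Rle_trans with (m i * m i / enorm u * (m i * m i * (enorm u * enorm u))).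
    + replace (m i * m i / enorm u * (m i * m i * (enorm u * enorm u))) with (m i ^ 4 * enorm u) by (field; lra).
      apply Rmult_le_compat_l; [left; now apply pow_lt | exact Hi].
    + replace (- (M ^ 3 * dot (x k) (acceleration m x k) * dot (x k) (x k)))
        with (- (M * dot (x k) (acceleration m x k)) * (M * M * dot (x k) (x k))) by ring.
      apply Rmult_le_compat; auto; [apply Rdiv_le_0_compat; nra|].
      repeat apply Rmult_le_pos; lra.
Qed.

Lemma cross_lagrange u w : dot (cross u w) (cross u w) = dot u u * dot w w - dot u w * dot u w.
Proof. rewrite !dot_coord, !coord_cross. ring. Qed.

(* In Jacobi coordinates the angular momentum splits into that of the pair
   [i], [j] and that of [k]. *)
Lemma angular_momentum_jacobi m x w (i j k : body) c : (forall i, 0 < m i) ->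
  i <> j -> i <> k -> j <> k -> centered m x -> zero_momentum m w ->
  coord c (angular_momentum m x w) =
  m k * (m i + m j + m k) / (m i + m j) * coord c (cross (x k) (w k))
  + m i * m j / (m i + m j) * coord c (cross (minus (x i) (x j)) (minus (w i) (w j))).
Proof.
  intros hm Hij Hik Hjk Hx Hw. assert (Mi := hm i). assert (Mj := hm j).
  unfold angular_momentum. rewrite coord_sum_bodies, (sum_bodies_distinct i j k), !coord_scal by auto.
  assert (Ei : forall y, centered m y -> forall c, coord c (y i) =
    - (m k / (m i + m j)) * coord c (y k) + m j / (m i + m j) * coord c (minus (y i) (y j))).
  { intros y Hy c'. assert (E := centered_distinct m y i j k c' Hij Hik Hjk Hy).
    rewrite coord_minus. apply Rmult_eq_reg_l with (m i + m j); [|lra]. field_simplify; lra. }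
  assert (Ej : forall y, centered m y -> forall c, coord c (y j) =
    - (m k / (m i + m j)) * coord c (y k) - m i / (m i + m j) * coord c (minus (y i) (y j))).
  { intros y Hy c'. assert (E := centered_distinct m y i j k c' Hij Hik Hjk Hy).
    rewrite coord_minus. apply Rmult_eq_reg_l with (m i + m j); [|lra]. field_simplify; lra. }
  rewrite !coord_cross.
  destruct c; rewrite !(Ei x Hx), !(Ei w Hw), !(Ej x Hx), !(Ej w Hw); field; lra.
Qed.

(** The Jacobi splitting expresses [x k x w k] by [J] and the angular momentum of the pair, which
    [pair_bound] controls; then [|a - b|^2 <= 2 |a|^2 + 2 |b|^2]. The outer distances are only
    assumed at least 1, so that the bound does not involve the [D] still to be chosen. *)
Lemma outer_cross_bound m x w (i j k : body) H J R0 : (forall i, 0 < m i) ->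
  i <> j -> i <> k -> j <> k -> centered m x -> zero_momentum m w ->
  energy m x w = H -> H < 0 -> angular_momentum m x w = J ->
  0 < enorm (minus (x i) (x j)) <= R0 ->
  1 <= enorm (minus (x i) (x k)) -> 1 <= enorm (minus (x j) (x k)) ->
  dot (cross (x k) (w k)) (cross (x k) (w k)) <=
  ((m i + m j) / (m k * (m i + m j + m k))) ^ 2 *
  (2 * dot J J + 2 * (m i * m j / (m i + m j)) ^ 2 * pair_bound (m i) (m j) (m k) R0 1).
Proof.
  intros hm Hij Hik Hjk Hx Hw HE HH HJ Hr Hi Hj.
  assert (Mi := hm i). assert (Mj := hm j). assert (Mk := hm k).
  set (L := cross (minus (x i) (x j)) (minus (w i) (w j))).
  set (C := cross (x k) (w k)).
  set (kap := (m i + m j) / (m k * (m i + m j + m k))). set (lam := m i * m j / (m i + m j)).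
  assert (HL : dot L L <= pair_bound (m i) (m j) (m k) R0 1).
  { assert (P := pair_bound_correct m x w i j k H R0 1 hm Hij Hik Hjk HE HH Rlt_0_1 Hr Hi Hj).
    unfold L. rewrite cross_lagrange.
    assert (S := Rle_0_sqr (dot (minus (x i) (x j)) (minus (w i) (w j)))). unfold Rsqr in S. lra. }
  assert (HC : forall c, coord c C = kap * (coord c J - lam * coord c L)).
  { intros c. rewrite <- HJ, (angular_momentum_jacobi m x w i j k c) by auto.
    fold L C. unfold kap, lam. field. repeat split; lra. }
  rewrite (dot_coord C), !HC.
  assert (0 <= (coord axis1 J + lam * coord axis1 L) ^ 2 + (coord axis2 J + lam * coord axis2 L) ^ 2
    + (coord axis3 J + lam * coord axis3 L) ^ 2)
    by (repeat apply Rplus_le_le_0_compat; apply pow2_ge_0).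
  apply Rle_trans with (kap ^ 2 * (2 * dot J J + 2 * lam ^ 2 * dot L L)).
  - rewrite !dot_coord. apply Rminus_le.
    match goal with |- ?e <= 0 => replace e with (- (kap ^ 2 *
      ((coord axis1 J + lam * coord axis1 L) ^ 2 + (coord axis2 J + lam * coord axis2 L) ^ 2
       + (coord axis3 J + lam * coord axis3 L) ^ 2))) by ring end.
    assert (0 <= kap ^ 2) by apply pow2_ge_0. nra.
  - apply Rmult_le_compat_l; [apply pow2_ge_0|].
    apply Rplus_le_compat_l, Rmult_le_compat_l; [|exact HL].
    assert (0 <= lam ^ 2) by apply pow2_ge_0. lra.
Qed.

(* The displayed inequality says that the second derivative of [|x k|] is negative. *)
Lemma outer_distance_concave m H J R0 (i j k : body) : (forall i, 0 < m i) ->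
  H < 0 -> i <> j -> i <> k -> j <> k ->
  exists D0, forall D, D0 <= D -> forall x w,
    centered m x -> zero_momentum m w -> energy m x w = H -> angular_momentum m x w = J ->
    0 < enorm (minus (x i) (x j)) <= R0 ->
    D <= enorm (minus (x i) (x k)) -> D <= enorm (minus (x j) (x k)) ->
    0 < dot (x k) (x k) /\
    (dot (w k) (w k) + dot (x k) (acceleration m x k)) * dot (x k) (x k)
      - dot (x k) (w k) * dot (x k) (w k) < 0.
Proof.
  intros hm HH Hij Hik Hjk.
  assert (Mi := hm i). assert (Mj := hm j). assert (Mk := hm k).
  set (M := m i + m j + m k). assert (HM : 0 < M) by (unfold M; lra).
  set (K := ((m i + m j) / (m k * (m i + m j + m k))) ^ 2 *
    (2 * dot J J + 2 * (m i * m j / (m i + m j)) ^ 2 * pair_bound (m i) (m j) (m k) R0 1)).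
  (* The entries make the bound on the cross product available, make the pair no wider than [D], and
     force [m i ^ 4 * D > K * M ^ 3], so that attraction beats the centrifugal term. *)
  exists (Rmax 1 (Rmax R0 (K * M ^ 3 / m i ^ 4 + 1))). intros D HD x w Hx Hw HE HJ Hr Hi Hj.
  assert (D1 : 1 <= D) by (eapply Rle_trans; [apply Rmax_l | exact HD]).
  assert (D' := Rle_trans _ _ _ (Rmax_r _ _) HD).
  assert (D2 : R0 <= D) by (eapply Rle_trans; [apply Rmax_l | exact D']).
  assert (D3 := Rle_trans _ _ _ (Rmax_r _ _) D').
  destruct (outer_attraction m x i j k D) as [HS HA]; auto; try lra.
  fold M in HA. split; [exact HS|].
  assert (HK := outer_cross_bound m x w i j k H J R0 hm Hij Hik Hjk Hx Hw HE HH HJ Hr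
    ltac:(lra) ltac:(lra)). fold K in HK.
  rewrite cross_lagrange in HK.
  assert (M4 : 0 < m i ^ 4) by now apply pow_lt.
  assert (M3 : 0 < M ^ 3) by now apply pow_lt.
  assert (HKD : K * M ^ 3 < m i ^ 4 * D).
  { apply Rlt_le_trans with (m i ^ 4 * (K * M ^ 3 / m i ^ 4 + 1)); [|apply Rmult_le_compat_l; lra].
    replace (m i ^ 4 * (K * M ^ 3 / m i ^ 4 + 1)) with (K * M ^ 3 + m i ^ 4) by (field; lra). lra. }
  assert (HKA : K < - (dot (x k) (acceleration m x k) * dot (x k) (x k))).
  { apply Rmult_lt_reg_r with (M ^ 3); auto. lra. }
  lra.
Qed.

Lemma eventually_all_bodies (P : body -> R -> Prop) :
  (forall i, exists D0, forall D, D0 <= D -> P i D) ->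
  exists D0, forall D, D0 <= D -> forall i, P i D.
Proof.
  intros H. destruct (H body1) as [d1 H1], (H body2) as [d2 H2], (H body3) as [d3 H3].
  exists (Rmax d1 (Rmax d2 d3)). intros D HD.
  assert (L1 := Rmax_l d1 (Rmax d2 d3)). assert (L2 := Rmax_r d1 (Rmax d2 d3)).
  assert (L3 := Rmax_l d2 d3). assert (L4 := Rmax_r d2 d3).
  intros []; [apply H1 | apply H2 | apply H3]; lra.
Qed.

(** [I0] is fixed before the orbit, hence before it is known which bodies form the pair; one [D0]
    has to serve all labelings. *)
Lemma outer_distance_concave_uniform m H J R0 : (forall i, 0 < m i) -> H < 0 ->
  exists D0, forall D, D0 <= D -> forall i j k, i <> j -> i <> k -> j <> k -> forall x w,
    centered m x -> zero_momentum m w -> energy m x w = H -> angular_momentum m x w = J ->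
    0 < enorm (minus (x i) (x j)) <= R0 ->
    D <= enorm (minus (x i) (x k)) -> D <= enorm (minus (x j) (x k)) ->
    0 < dot (x k) (x k) /\
    (dot (w k) (w k) + dot (x k) (acceleration m x k)) * dot (x k) (x k)
      - dot (x k) (w k) * dot (x k) (w k) < 0.
Proof.
  intros hm HH.
  do 3 (apply eventually_all_bodies; intros ?).
  (* Triples with a repetition satisfy the claim vacuously, so 0 is an arbitrary value for them. *)
  destruct (body_eq_dec i i0) as [E|N1]; [exists 0; intros; contradiction|].
  destruct (body_eq_dec i i1) as [E|N2]; [exists 0; intros; contradiction|].
  destruct (body_eq_dec i0 i1) as [E|N3]; [exists 0; intros; contradiction|].
  destruct (outer_distance_concave m H J R0 i i0 i1 hm HH N1 N2 N3) as [D0 HD0].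
  exists D0. intros D HD _ _ _. now apply HD0.
Qed.

(** * Choice of the threshold and exclusion of orbits that stay outside it *)

Theorem theorem1 (m : body -> R) (hm : forall i, 0 < m i)
    (H : R) (hH : H < 0) (J : vec3) :
  exists I0 : R, 0 < I0 /\
    forall (a b : Rbar) (q v : body -> R -> vec3),
      orbit m a b q v ->
      centered m (fun i => q i 0) ->
      zero_momentum m (fun i => v i 0) ->
      energy m (fun i => q i 0) (fun i => v i 0) = H ->
      angular_momentum m (fun i => q i 0) (fun i => v i 0) = J ->
      I0 < moment_of_inertia m (fun i => q i 0) ->
      (exists t : R, 0 < t /\ Rbar_lt t b /\
         moment_of_inertia m (fun i => q i t) <= I0) \/
      (exists t : R, t < 0 /\ Rbar_lt a t /\
         moment_of_inertia m (fun i => q i t) <= I0).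
Proof.
  set (A := m body1 * m body2 + m body1 * m body3 + m body2 * m body3).
  assert (M1 := hm body1). assert (M2 := hm body2). assert (M3 := hm body3).
  assert (HA : 0 < A) by (unfold A; repeat apply Rplus_lt_0_compat; apply Rmult_lt_0_compat; auto).
  set (R0 := A / - H). assert (HR0 : 0 < R0) by (apply Rdiv_lt_0_compat; lra).
  destruct (outer_distance_concave_uniform m H J R0 hm hH) as [D0 HD0].
  (* [D0] ensures concavity; [R0 + 1] opens the gap that keeps the pair from changing. *)
  set (D := Rmax D0 (R0 + 1)).
  specialize (HD0 D (Rmax_l _ _)). assert (HD : R0 + 1 <= D) by apply Rmax_r.
  exists (inertia_threshold m R0 D). split.
  { unfold inertia_threshold. fold A. apply Rdiv_lt_0_compat; [|lra].
    apply Rmult_lt_0_compat; auto. apply pow_lt; lra. }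
  intros a b q v (Ha & Hb & Hmax & Hnb) Hc0 Hp0 HE0 HJ0 HI0.
  apply NNPP; intros Hno.
  assert (H0 : in_interval a b 0) by (split; assumption).
  assert (HI : forall t, in_interval a b t -> inertia_threshold m R0 D < moment_of_inertia m (fun i => q i t)).
  { intros t [Hat Htb]. apply Rnot_le_lt; intros Hle. apply Hno.
    destruct (total_order_T t 0) as [[Ht|Ht]|Ht]; [right; now exists t | subst t; lra | left; now exists t]. }
  assert (Hs := proj1 Hmax).
  assert (Hcons := conservation_laws m a b q v H J hm Hs H0 Hc0 Hp0 HE0 HJ0).
  assert (Hconf : forall t, in_interval a b t ->
    exists i j k, i <> j /\ i <> k /\ j <> k /\ enorm (minus (q i t) (q j t)) <= R0 /\
      D <= enorm (minus (q i t) (q k t)) /\ D <= enorm (minus (q j t) (q k t))).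
  { intros t Ht. destruct (Hcons t Ht) as (C1 & C2 & C3 & C4).
    apply (hierarchical_configuration m (fun i => q i t) (fun i => v i t) H R0 D); auto; try lra.
    intros i j. now apply (Hs t Ht). }
  destruct (Hconf 0 H0) as (i & j & k & Hij & Hik & Hjk & Hr0 & _).
  (* At each time the distance of [i] and [j] is either that of the tight pair, at most [R0], or an
     outer one, at least [D]. Continuity from time 0 excludes the latter. *)
  assert (Hr : forall t, in_interval a b t -> enorm (minus (q i t) (q j t)) <= R0).
  { apply (continuous_confined a b _ R0 D); auto; [lra|].
    intros t Ht. split.
    - destruct (solution_newton_at m a b q v t hm Hs Ht) as (Hn & Hq & _).
      apply @ex_derive_continuous. eexists.
      apply is_derive_enorm; [now apply minus_neq_zero, Hn|].
      apply (is_derive_minus (q i) (q j)); apply Hq.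
    - destruct (Hconf t Ht) as (i' & j' & k' & N1 & N2 & N3 & R1 & R2 & R3).
      assert (S1 := enorm_minus_sym (q i' t) (q j' t)). assert (S2 := enorm_minus_sym (q i' t) (q k' t)).
      assert (S3 := enorm_minus_sym (q j' t) (q k' t)).
      destruct i, j; try congruence; destruct i', j', k'; try congruence;
        (left; lra) || (right; lra). }
  (* As [R0 < D], the bodies [i] and [j] must form the tight pair found at time [t], up to order. *)
  assert (Hfar : forall t, in_interval a b t ->
    D <= enorm (minus (q i t) (q k t)) /\ D <= enorm (minus (q j t) (q k t))).
  { intros t Ht. specialize (Hr t Ht).
    destruct (Hconf t Ht) as (i' & j' & k' & N1 & N2 & N3 & R1 & R2 & R3).
    assert (S1 := enorm_minus_sym (q i' t) (q j' t)). assert (S2 := enorm_minus_sym (q i' t) (q k' t)).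
    assert (S3 := enorm_minus_sym (q j' t) (q k' t)).
    destruct i, j, k; try congruence; destruct i', j', k'; try congruence; split; lra. }
  assert (Hall : forall t, in_interval a b t ->
    centered m (fun i => q i t) /\
    energy m (fun i => q i t) (fun i => v i t) = H /\
    enorm (minus (q i t) (q j t)) <= R0 /\
    D <= enorm (minus (q i t) (q k t)) /\ D <= enorm (minus (q j t) (q k t))).
  { intros t Ht. destruct (Hcons t Ht) as (C1 & C2 & C3 & C4). repeat split; auto; now apply Hfar. }
  assert (HDp : 0 < D) by lra.
  (* Finite endpoints are ruled out on both sides, which leaves an orbit defined on the whole
     line. *)
  destruct b as [b| |]; [|clear Hb|destruct Hb].
  { exact (hierarchical_forward_complete m a b q v i j k H R0 D hm Hij Hik Hjk hH HDp H0 Hmax Hnb Hall). }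
  destruct a as [a| |]; [|destruct Ha|clear Ha].
  { exact (hierarchical_backward_complete m a p_infty q v i j k H R0 D hm Hij Hik Hjk hH HDp H0 Hmax Hnb Hall). }
  assert (Hin : forall t, in_interval m_infty p_infty t) by (intros t; split; exact I).
  assert (Hcc : forall t, 0 < dot (q k t) (q k t) /\
    (dot (v k t) (v k t) + dot (q k t) (acceleration m (fun j => q j t) k)) * dot (q k t) (q k t)
      - dot (q k t) (v k t) * dot (q k t) (v k t) < 0).
  { intros t. destruct (Hcons t (Hin t)) as (C1 & C2 & C3 & C4).
    destruct (Hfar t (Hin t)) as [F1 F2].
    apply (HD0 i j k Hij Hik Hjk (fun i => q i t) (fun i => v i t)); auto.
    split; [|now apply Hr]. apply enorm_pos. now apply (Hs t (Hin t)). }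
  assert (Hpos : forall t, 0 < enorm (q k t)) by (intros t; apply sqrt_lt_R0, Hcc).
  assert (Dq : forall t, is_derive (fun t => enorm (q k t)) t (dot (q k t) (v k t) / enorm (q k t))).
  { intros t. apply is_derive_enorm.
    - intros E. destruct (Hcc t) as [P _]. rewrite E, dot_coord, !coord_zero in P. lra.
    - apply (solution_newton_at m _ _ q v t hm Hs (Hin t)). }
  (* The third function is the derivative of [q k . v k / |q k|] over a common denominator; its
     numerator is the expression that [Hcc] shows to be negative. *)
  apply (positive_not_strictly_concave (fun t => enorm (q k t))
    (fun t => dot (q k t) (v k t) / enorm (q k t))
    (fun t => ((dot (v k t) (v k t) + dot (q k t) (acceleration m (fun j => q j t) k)) * dot (q k t) (q k t)
      - dot (q k t) (v k t) * dot (q k t) (v k t)) / enorm (q k t) ^ 3)).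
  - exact Dq.
  - intros t. destruct (solution_newton_at m _ _ q v t hm Hs (Hin t)) as (_ & Hq & Hv).
    eapply is_derive_eq; cycle 1.
    + apply is_derive_div; [apply is_derive_dot; [apply Hq | apply Hv] | apply Dq | apply Rgt_not_eq, Hpos].
    + cbv beta. rewrite <- (enorm_sqr (q k t)). specialize (Hpos t). field. lra.
  - exact Hpos.
  - intros t. destruct (Hcc t) as [_ Hneg].
    apply Ropp_lt_cancel. rewrite Ropp_0, <- Rdiv_opp_l. apply Rdiv_lt_0_compat; [lra|].
    apply pow_lt, Hpos.
Qed.
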